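(* Let $d,m,r$ be nonnegative integers with $m+r=d\ge 1$, and let $Y_n=(S_n^{(1)},\dots,S_n^{(m)},Z_n^{(1)},\dots,Z_n^{(r)})$, $n\in\mathbb N$, be the Markov chain on $\mathbb Z^d$ whose coordinates are $m$ simple symmetric random walks and $r$ recurrent random walks in random environment in $I$ independent environments, as described in the context. If $m\le 1$, or if $m=d=2$, then, for $\mathsf P$-almost every $\omega$, the random walk $Y=(Y_n)_n$ is recurrent with respect to $P^0_\omega$. Otherwise, for $\mathsf P$-almost every $\omega$, the random walk $Y$ is transient with respect to $P^0_\omega$.
   Context: Setting. Let $I\le r$ (with $I\ge 1$ if $r\ge1$). On a probability space $(\Omega,\mathcal F,\mathsf P)$ (expectation $\mathsf E$) there are $r$ collections $\omega^{(j)}=(\omega^{(j)}_x)_{x\in\mathbb Z}$, $j\in\{1,\dots,r\}$, each made of i.i.d. random variables with values in $(0,1)$, such that $\omega^{(1)},\dots,\omega^{(I)}$ are independent and, for every $j\in\{I+1,\dots,r\}$, there is an index $J_j\in\{1,\dots,I\}$ with $\omega^{(j)}\equiv\omega^{(J_j)}$ (exact copy). A realization $\omega=(\omega^{(1)},\dots,\omega^{(r)})$ is called an environment. With $\rho^{(j)}_k=(1-\omega^{(j)}_k)/\omega^{(j)}_k$, assume there is $\varepsilon_0\in(0,1/2)$ such that for every $j\in\{1,\dots,r\}$: $\mathsf P[\omega^{(j)}_0\in[\varepsilon_0,1-\varepsilon_0]]=1$, $\mathsf E[\log\rho^{(j)}_0]=0$ and $\mathsf E[(\log\rho^{(j)}_0)^2]>0$.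 Given $\omega$ and $x\in\mathbb Z^d$, under the quenched law $P^x_\omega$ the processes $S^{(1)},\dots,S^{(m)},Z^{(1)},\dots,Z^{(r)}$ are independent Markov chains on $\mathbb Z$ with $P^x_\omega(Y_0=x)=1$, where each $S^{(i)}$ jumps by $+1$ or $-1$ with probability $1/2$ each, and $P^x_\omega[Z^{(j)}_{n+1}=y+1\mid Z^{(j)}_n=y]=\omega^{(j)}_y=1-P^x_\omega[Z^{(j)}_{n+1}=y-1\mid Z^{(j)}_n=y]$ for $y\in\mathbb Z$, $n\in\mathbb N$. Here $0$ also denotes the origin of $\mathbb Z^d$. Recurrence of $Y$ with respect to $P^0_\omega$ means that $P^0_\omega$-almost surely $Y_n=0$ for infinitely many $n$; transience means that $P^0_\omega$-almost surely $Y_n=0$ for only finitely many $n$. *)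

(* Defs.v *)
From HB Require Import structures.
From mathcomp Require Import all_boot all_order all_algebra finmap.
From mathcomp Require Import all_classical all_reals all_analysis.

Set Implicit Arguments.
Unset Strict Implicit.
Unset Printing Implicit Defensive.

Import Order.TTheory GRing.Theory Num.Theory.
Import numFieldNormedType.Exports.

Local Open Scope classical_set_scope.
Local Open Scope ring_scope.

HB.instance Definition _ := isPointed.Build int 0.
HB.instance Definition _ := @isMeasurable.Build default_measure_display
  int (@discrete_measurable int) (@discrete_measurable0 int)
  (@discrete_measurableC int) (@discrete_measurableU int).

Definition sigma_of d d' (T : measurableType d) (E : measurableType d')
    (A : Type) (X : A -> T -> E) : set (set T) :=
  <<s \bigcup_(a in [set: A]) preimage_set_system setT (X a) measurable >>.

Definition independent d (T : measurableType d) (R : realType)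
    (P : probability T R) (A : choiceType) (G : A -> set (set T)) : Prop :=
  forall (J : {fset A}) (B : A -> set T),
    (forall a, a \in J -> G a (B a)) ->
    P (\bigcap_(a in [set` J]) B a) = (\prod_(a <- J) P (B a))%E.

Definition iid d (T : measurableType d) (R : realType) (P : probability T R)
    (X : int -> {RV P >-> R}) : Prop :=
  independent P (fun x => g_sigma_algebra_preimage (X x)) /\
  (forall x B, measurable B -> distribution P (X x) B = distribution P (X 0) B).

Definition rho (R : realType) (a : R) : R := (1 - a) / a.

Definition cond_prob d (T : measurableType d) (R : realType)
    (P : probability T R) (A B : set T) : R :=
  fine (P (A `&` B)) / fine (P B).

(* The Markov property and the one-step transition probabilities, at once. *)
Definition markov_chain d (T : measurableType d) (R : realType)
    (P : probability T R) (p : int -> int -> R) (X : nat -> T -> int) : Prop :=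
  forall (n : nat) (y : nat -> int) (z : int),
    let past := [set t | forall k, (k <= n)%N -> X k t = y k] in
    P past != 0%E -> cond_prob P [set t | X n.+1 t = z] past = p (y n) z.

Definition nn_kernel (R : realType) (q : int -> R) (y z : int) : R :=
  if z == y + 1 then q y else if z == y - 1 then 1 - q y else 0.

Definition walk (T : Type) (m r : nat) (S : 'I_m -> nat -> T -> int)
    (Z : 'I_r -> nat -> T -> int) (n : nat) (t : T) : 'rV[int]_(m + r) :=
  row_mx (\row_i S i n t) (\row_j Z j n t).

(* [Q] is a quenched law P^x_e, in the environment [e], of the walk with
   coordinate processes [S] and [Z]. *)
Record quenched_law d (T : measurableType d) (R : realType) (m r : nat)
    (S : 'I_m -> nat -> {mfun T >-> int}) (Z : 'I_r -> nat -> {mfun T >-> int})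
    (e : 'I_r -> int -> R) (x : 'rV[int]_(m + r)) (Q : probability T R) : Prop
    := QuenchedLaw {
  quenched_independent : independent Q (fun c : 'I_m + 'I_r =>
    match c with inl i => sigma_of (S i) | inr j => sigma_of (Z j) end);
  quenched_start : Q [set t | walk S Z 0 t = x] = 1%E;
  quenched_srw : forall i, markov_chain Q (nn_kernel (fun=> 2^-1)) (S i);
  quenched_rwre : forall j, markov_chain Q (nn_kernel (e j)) (Z j) }.

Definition recurrent d (T : measurableType d) (R : realType)
    (Q : probability T R) (k : nat) (Y : nat -> T -> 'rV[int]_k) : Prop :=
  {ae Q, forall t, infinite_set [set n | Y n t = 0]}.

Definition transient d (T : measurableType d) (R : realType)
    (Q : probability T R) (k : nat) (Y : nat -> T -> 'rV[int]_k) : Prop :=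
  {ae Q, forall t, finite_set [set n | Y n t = 0]}.

(* Main.v *)
Require Import Defs.
From HB Require Import structures.
From mathcomp Require Import all_boot all_order all_algebra finmap.
From mathcomp Require Import all_classical all_reals all_analysis.
From mathcomp Require Import measurable_realfun.
From mathcomp Require Import ring lra zify.

Set Implicit Arguments.
Unset Strict Implicit.
Unset Printing Implicit Defensive.

Import Order.TTheory GRing.Theory Num.Theory.
Import numFieldNormedType.Exports.

Local Open Scope classical_set_scope.
Local Open Scope ring_scope.

(* The coordinates are independent under the quenched law, so [P(Y_n = 0)] is
   the product of the one-dimensional return probabilities [pn q n 0 0]. The
   joint chain is recurrent when these have an infinite sum (last-return
   decomposition) and transient when the sum is finite (Borel-Cantelli). A
   simple random walk contributes a factor of order [n^(-1/2)].

   A walk in an environment is reversible with respect to [exp(-V)], where [V]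
   is a sum of the [log rho]. Two estimates on return probabilities suffice:
   - if [V] descends to [-a] at distance [x] before reaching [H], on one side of
     the origin, then [sum_(k < n) p_k(0, 0) <= C (x exp H + n exp(-a))];
   - if on both sides [V] reaches height [3 h] before [-2 delta h], within
     distance [L], then [p_2n(0, 0) >= c exp(-2 delta h) / L] for [n <= 4^h].
   As a function of the site, [V] is a centred random walk with bounded steps,
   so optional stopping controls on which side and when it exits [(-a, H)].

   For [m = 2], at scale [h = 2^j] with [a] of order [log h], one side fails to
   descend with probability [O(log h / h)]; both sides fail with probability
   [O((log h / h)^2)], which is summable over [j]. Hence almost surely
   [sum_k p_2k(0, 0) / k] is finite.

   For [m <= 1], on disjoint blocks of sites at rapidly growing scales [h], all
   environments have the second property on both sides with probability bounded
   below, hence infinitely often. Choosing [delta = 1 / (8 (r + 1))] makes the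
   product of the [r] return probabilities much larger than [2^(-h)], while the
   simple random walk yields [sum_(n <= 4^h) n^(-1/2) >= 2^h]. *)

(** * Return probabilities of nearest-neighbour chains *)

Section TransitionFunction.
Context (R : realType).
Implicit Types (q : int -> R) (x y z : int) (n k : nat).

(** Transition probabilities are given by recursion on the first step, not through the law of a
    process, so the estimates on them are purely analytic. [sum_weight_pn] makes the link with paths
    of the chain. *)
Fixpoint pn q n x y : R :=
  if n is n'.+1 then q x * pn q n' (x + 1) y + (1 - q x) * pn q n' (x - 1) y
  else (x == y)%:R.

Definition prob_env q := forall x, 0 < q x < 1.

Lemma pn_ge0 q n x y : prob_env q -> 0 <= pn q n x y.
Proof.
move=> q01; elim: n x => [|n IH] x /=; first exact: ler0n.
have /andP[q0 q1] := q01 x.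
by rewrite addr_ge0 ?mulr_ge0 ?IH ?subr_ge0 // ltW.
Qed.

Lemma pn_le1 q n x y : prob_env q -> pn q n x y <= 1.
Proof.
move=> q01; elim: n x => [|n IH] x /=; first by rewrite lern1 leq_b1.
have /andP[q0 q1] := q01 x.
have := IH (x + 1); have := IH (x - 1).
set a := pn _ _ _ _; set b := pn _ _ _ _ => a1 b1.
have : 0 <= (1 - q x) * (1 - a) by rewrite mulr_ge0 // subr_ge0 // ltW.
have : 0 <= q x * (1 - b) by rewrite mulr_ge0 // ?subr_ge0 // ltW.
by move: a b a1 b1 => a b a1 b1 h1 h2; lra.
Qed.

(** The last-step counterpart of the recursion. Reversing a path exchanges its first and last steps,
    so reversibility needs both forms. *)
Lemma pnSr q n x y : pn q n.+1 x y =
  pn q n x (y - 1) * q (y - 1) + pn q n x (y + 1) * (1 - q (y + 1)).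
Proof.
elim: n x => [|n IH] x.
  have -> : pn q 1 x y = q x * (x + 1 == y)%:R + (1 - q x) * (x - 1 == y)%:R by [].
  have -> : pn q 0 x (y - 1) = (x + 1 == y)%:R by congr (_%:R); lia.
  have -> : pn q 0 x (y + 1) = (x - 1 == y)%:R by congr (_%:R); lia.
  have [e1|_] := eqVneq (x + 1) y; have [e2|_] := eqVneq (x - 1) y.
  - by exfalso; lia.
  - by rewrite -e1 addrK !mulr0 mul0r mulrC.
  - by rewrite -e2 subrK !mulr0 mul0r !add0r mulrC.
  - by rewrite !mulr0 !mul0r.
transitivity (q x * pn q n.+1 (x + 1) y + (1 - q x) * pn q n.+1 (x - 1) y) => //.
by rewrite !IH /=; ring.
Qed.

(** The environment seen after the reflection [x -> -x], which also exchanges up and down steps.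
    Through it, statements about the negative half-line reduce to the positive one. *)
Definition reflect_env q y : R := 1 - q (- y).

Lemma reflect_envK q : reflect_env (reflect_env q) = q.
Proof. by apply/funext => x; rewrite /reflect_env opprK opprB addrC subrK. Qed.

Lemma prob_env_reflect q : prob_env q -> prob_env (reflect_env q).
Proof. by move=> q01 x; have := q01 (- x); rewrite /reflect_env; lra. Qed.

Lemma pn_reflect q n x y : pn (reflect_env q) n x y = pn q n (- x) (- y).
Proof.
elim: n x => [|n IH] x /=; first by rewrite eqr_opp.
have e1 : - (x + 1) = - x - 1 by ring.
have e2 : - (x - 1) = - x + 1 by ring.
by rewrite !IH /reflect_env e1 e2; ring.
Qed.

Lemma pn_parity q n x y : odd (n + `|x - y|%N) -> pn q n x y = 0.
Proof.
elim: n x => [|n IH] x /=.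
  by rewrite add0n; case: (x =P y) => // ->; rewrite subrr.
by move=> o; rewrite !IH ?mulr0 ?addr0 //; lia.
Qed.

Lemma pn_odd0 q n : odd n -> pn q n 0 0 = 0.
Proof. by move=> o; apply: pn_parity; rewrite subrr addn0. Qed.

(** The sum runs over the sites [1, ..., n]; the left side is handled by [reflect_env q], which uses
    [-1, ..., -n]. The origin enters neither side, so the two sides depend on disjoint sets of
    sites. *)
Definition potential q n : R := \sum_(0 <= l < n) ln (rho (q l.+1%:Z)).

Lemma potentialS q n : potential q n.+1 = potential q n + ln (rho (q n.+1%:Z)).
Proof. by rewrite /potential big_nat_recr. Qed.

Lemma rho_gt0 (a : R) : 0 < a < 1 -> 0 < rho a.
Proof. by move=> /andP[a0 a1]; rewrite /rho divr_gt0 ?subr_gt0. Qed.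

Lemma rho_mul (a : R) : 0 < a < 1 -> rho a * a = 1 - a.
Proof. by move=> /andP[a0 a1]; rewrite /rho divfK ?gt_eqF. Qed.

Lemma expR_potentialS q n : prob_env q ->
  expR (potential q n.+1) = expR (potential q n) * rho (q n.+1%:Z).
Proof. by move=> q01; rewrite potentialS expRD lnK // posrE rho_gt0. Qed.

(* [rev_measure] is the reversible measure of the walk with mass 1 at 0. *)
Definition half_measure q n : R := expR (- potential q n) * q 0 / q n%:Z.

Definition rev_measure q x : R :=
  match x with Posz n => half_measure q n | Negz n => half_measure (reflect_env q) n.+1 end.

Lemma half_measure0 q : prob_env q -> half_measure q 0 = 1.
Proof.
move=> q01; rewrite /half_measure /potential big_geq // oppr0 expR0 mul1r divff //.
by have /andP[/gt_eqF->] := q01 0.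
Qed.

Lemma rev_measure_reflect q x : prob_env q ->
  rev_measure (reflect_env q) x = rev_measure q (- x).
Proof.
move=> q01; have r01 := prob_env_reflect q01.
case: x => [[|n]|n] /=.
- by rewrite !half_measure0.
- by [].
- by rewrite reflect_envK.
Qed.

Lemma half_measure_balance q n : prob_env q ->
  half_measure q n * q n%:Z = half_measure q n.+1 * (1 - q n.+1%:Z).
Proof.
move=> q01; rewrite /half_measure !expRN expR_potentialS // invfM.
have := rho_gt0 (q01 n.+1%:Z); have := rho_mul (q01 n.+1%:Z).
set r := rho _ => e r0.
have /andP[/gt_eqF/negbT a0 _] := q01 n%:Z.
have /andP[/gt_eqF/negbT b0 _] := q01 n.+1%:Z.
have := expR_gt0 (potential q n) => /gt_eqF/negbT; set E := expR _ => E0.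
rewrite -e; field.
by rewrite a0 b0 E0 gt_eqF.
Qed.

Lemma rev_measure_balance q x : prob_env q ->
  rev_measure q x * q x = rev_measure q (x + 1) * (1 - q (x + 1)).
Proof.
move=> q01; case: x => n.
  by rewrite [(Posz n + 1)%R](_ : _ = Posz n.+1) /= ?half_measure_balance //; lia.
have r01 := prob_env_reflect q01.
have -> : Negz n + 1 = - n%:Z by lia.
rewrite -rev_measure_reflect //=.
have := half_measure_balance n r01.
by rewrite /reflect_env -NegzE; set a := half_measure _ n; set b := half_measure _ _ => e; lra.
Qed.

Lemma half_measure_gt0 q n : prob_env q -> 0 < half_measure q n.
Proof.
move=> q01; rewrite /half_measure.
have /andP[? _] := q01 0; have /andP[? _] := q01 n%:Z.
by rewrite divr_gt0 ?mulr_gt0 ?expR_gt0.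
Qed.

Lemma rev_measure_gt0 q x : prob_env q -> 0 < rev_measure q x.
Proof.
move=> q01; case: x => n /=; apply: half_measure_gt0 => //.
exact: prob_env_reflect.
Qed.

(** Detailed balance along one edge propagates to paths: the induction splits off the last step on
    one side and the first step on the other. *)
Lemma pn_reversible q n x y : prob_env q ->
  rev_measure q x * pn q n x y = rev_measure q y * pn q n y x.
Proof.
move=> q01; elim: n x y => [|n IH] x y.
  by rewrite /= [y == x]eq_sym; case: eqP => [->|]; rewrite ?mulr0.
have := rev_measure_balance (y - 1) q01; rewrite subrK => e1.
have := rev_measure_balance y q01 => e2.
rewrite pnSr [pn q n.+1 y x]/=.
transitivity (rev_measure q x * pn q n x (y - 1) * q (y - 1) +
  rev_measure q x * pn q n x (y + 1) * (1 - q (y + 1))); first by ring.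
rewrite (IH x (y - 1)) (IH x (y + 1)) [X in X + _]mulrAC e1 [X in _ + X]mulrAC -e2.
by ring.
Qed.

End TransitionFunction.

(** * Upper and lower bounds on return probabilities *)

Section ReturnBounds.
Context (R : realType).
Implicit Types (q : int -> R) (x y z : int) (n k : nat).

Lemma pn_sumS q n z y : \sum_(0 <= k < n.+1) pn q k z y =
  (z == y)%:R + (q z * (\sum_(0 <= k < n) pn q k (z + 1) y)
    + (1 - q z) * (\sum_(0 <= k < n) pn q k (z - 1) y)).
Proof. by rewrite big_nat_recl //= big_split -!mulr_sumr. Qed.

Lemma mix_le (a u1 u2 v1 v2 : R) : 0 < a < 1 -> u1 <= v1 -> u2 <= v2 ->
  a * u1 + (1 - a) * u2 <= a * v1 + (1 - a) * v2.
Proof. by move=> /andP[a0 a1] h1 h2; rewrite lerD // ler_wpM2l // ?subr_ge0 ltW. Qed.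

(** As the origin has mass 1, reversibility turns [rev_measure q x * pn q n x 0] into [pn q n 0 x],
    which is at most 1. *)
Lemma pn_le_rev_measure q n x : prob_env q ->
  pn q n x 0 <= (rev_measure q x)^-1.
Proof.
move=> q01; have h := rev_measure_gt0 x q01.
rewrite -[leLHS](mulKf (lt0r_neq0 h)) -[leRHS]mulr1 ler_wpM2l ?invr_ge0 ?(ltW h) //.
by rewrite pn_reversible //= half_measure0 // mul1r pn_le1.
Qed.

(* The function [phi], constant left of 0 and decreasing to 0 at [x], satisfies
   [phi - P phi >= 1_0] on the left of [x]; at [x] itself reversibility bounds
   each return probability by [c]. *)
Lemma green_le q (x n : nat) : prob_env q ->
  \sum_(0 <= k < n) pn q k 0 0 <=
  (q 0)^-1 * (\sum_(0 <= i < x) expR (potential q i) + n%:R * expR (potential q x)).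
Proof.
move=> q01; have /andP[a0 a1] := q01 0.
pose ph m := (q 0)^-1 * \sum_(m <= i < x) expR (potential q i).
pose phi z := if z is Posz m then ph m else ph 0%N.
pose c := (q 0)^-1 * expR (potential q x).
have phi_ge0 z : 0 <= phi z.
  by case: z => m /=; rewrite mulr_ge0 ?invr_ge0 ?(ltW a0) // sumr_ge0 // => *; exact: expR_ge0.
have phE m : (m < x)%N -> ph m = (q 0)^-1 * expR (potential q m) + ph m.+1.
  by move=> mx; rewrite /ph big_ltn // mulrDr.
suff main z : z <= x%:Z -> \sum_(0 <= k < n) pn q k z 0 <= phi z + n%:R * c.
  by rewrite mulrDr mulrCA; exact: main.
have [phi_super bd] : (forall z, z < x%:Z ->
    (z == 0)%:R + (q z * phi (z + 1) + (1 - q z) * phi (z - 1)) <= phi z) /\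
    (forall k, pn q k x%:Z 0 <= c).
  split; last first.
    (* The inverse of the mass at [x] is [exp(V x) * q x / q 0], and [q x <= 1]. *)
    move=> k; apply: le_trans (pn_le_rev_measure _ _ q01) _.
    rewrite /= /half_measure expRN !invfM !invrK /c [leRHS]mulrC ler_piMr //.
      by rewrite mulr_ge0 ?expR_ge0 ?invr_ge0 ?(ltW a0).
    by have /andP[_ /ltW] := q01 x%:Z.
  case=> [[|m]|m] zx.
  - rewrite eqxx; change (phi (0%:Z - 1)) with (ph 0%N); change (phi (0%:Z + 1)) with (ph 1%N).
    change (phi 0%:Z) with (ph 0%N); rewrite (phE 0%N) // /potential big_geq // expR0.
    move: (ph 1%N) => t; rewrite mulr1n mulr1 le_eqVlt; apply/orP; left; apply/eqP; field.
    by rewrite gt_eqF.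
  (* Between 0 and [x] the function [phi] is harmonic: successive increments have ratio [rho], and
     [rho * b = 1 - b]. *)
  - have -> : Posz m.+1 + 1 = Posz m.+2 by lia.
    have -> : Posz m.+1 - 1 = Posz m by lia.
    have -> : (Posz m.+1 == 0) = false by [].
    have mx : (m.+1 < x)%N by [].
    rewrite mulr0n add0r /phi (phE m (ltnW mx)) (phE m.+1 mx) expR_potentialS //.
    have := rho_mul (q01 m.+1%:Z); move: (rho _) => r; move: (q m.+1%:Z) => b e.
    move: (ph m.+2) => t; move: (expR _) => E.
    rewrite le_eqVlt; apply/orP; left; apply/eqP.
    transitivity (t + (q 0)^-1 * E * (1 + r - b - r * b)); first by ring.
    by rewrite e; ring.
  - have -> : phi (Negz m - 1) = ph 0%N by have -> : Negz m - 1 = Negz m.+1 by lia.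
    have -> : phi (Negz m + 1) = ph 0%N by case: m {zx}.
    have -> : (Negz m == 0) = false by [].
    by rewrite mulr0n add0r -mulrDl addrC subrK mul1r.
elim: n z => [|n IH] z zx.
  by rewrite big_geq // mul0r addr0.
have [->|zx'] := eqVneq z x%:Z.
  apply: (@le_trans _ _ (n.+1%:R * c)); last by rewrite lerDr.
  rewrite -[n.+1 in leRHS]subn0 mulr_natl -sumr_const_nat.
  exact: ler_sum.
have zx2 : z < x%:Z by rewrite lt_neqAle zx' zx.
rewrite pn_sumS; apply: le_trans (lerD (lexx _) (mix_le (q01 z) (IH _ _) (IH _ _))) _.
- lia.
- lia.
have := phi_super z zx2; rewrite -natr1.
have c0 : 0 <= c by rewrite mulr_ge0 ?expR_ge0 // invr_ge0 ltW.
move: (z == 0)%:R (q z) (phi (z - 1)) (phi (z + 1)) (phi z) => d b f2 f1 f h.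
rewrite -subr_ge0 in h; rewrite -subr_ge0; apply: le_trans h _.
rewrite -subr_ge0; have -> : f + (n%:R + 1) * c -
  (d + (b * (f1 + n%:R * c) + (1 - b) * (f2 + n%:R * c))) -
  (f - (d + (b * f1 + (1 - b) * f2))) = c by ring.
exact: c0.
Qed.

Definition int_range (a b : nat) : seq int :=
  [seq i%:Z - a%:Z | i <- iota 0 (a + b).+1].

Lemma mem_int_range a b x : (x \in int_range a b) = (- a%:Z <= x <= b%:Z).
Proof.
apply/mapP/idP => [[i]|h]; first by rewrite mem_iota => h ->; lia.
by exists (absz (x + a%:Z)); rewrite ?mem_iota; lia.
Qed.

Lemma uniq_int_range a b : uniq (int_range a b).
Proof. by rewrite map_inj_uniq ?iota_uniq // => i j; lia. Qed.

Lemma sum_delta (D : seq int) z (F : int -> R) : uniq D -> z \in D ->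
  \sum_(x <- D) (z == x)%:R * F x = F z.
Proof.
move=> uD zD; rewrite (bigD1_seq z) //= eqxx mul1r big1 ?addr0 // => x /negPf.
by rewrite eq_sym => ->; rewrite mul0r.
Qed.

(** Chapman-Kolmogorov with the intermediate state confined to a finite set: only an inequality, but
    it avoids sums over all of [int] and suffices for lower bounds. *)
Lemma pn_chapman_ge q (D : seq int) n k z y : prob_env q -> uniq D ->
  \sum_(x <- D) pn q n z x * pn q k x y <= pn q (n + k) z y.
Proof.
move=> q01 uD; elim: n z => [|n IH] z.
  rewrite add0n /=; have [zD|zD] := boolP (z \in D); first by rewrite sum_delta.
  rewrite big_seq big1 ?pn_ge0 // => x xD.
  by case: eqP zD => [->|_ _]; rewrite ?xD ?mul0r.
rewrite addSn /=; apply: le_trans (mix_le (q01 z) (IH _) (IH _)).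
rewrite !mulr_sumr -big_split /=; apply: ler_sum => x _; move: (pn _ k x y) => t.
by rewrite mulrDl !mulrA.
Qed.

(* The walk leaves the interval only through its endpoints, so the two sums of
   visit probabilities dominate the probability of being outside at time [n]. *)
Lemma pn_mass q (a b n : nat) z : prob_env q -> z \in int_range a b ->
  1 <= \sum_(x <- int_range a b) pn q n z x
     + (\sum_(0 <= k < n.+1) pn q k z b%:Z + \sum_(0 <= k < n.+1) pn q k z (- a%:Z)).
Proof.
move=> q01; have sum0 x y k : 0 <= \sum_(0 <= i < k) pn q i x y.
  by apply: sumr_ge0 => *; exact: pn_ge0.
have sumD0 x k : 0 <= \sum_(y <- int_range a b) pn q k x y.
  by apply: sumr_ge0 => *; exact: pn_ge0.
have sum1 y k : 1 <= \sum_(0 <= i < k.+1) pn q i y y.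
  by rewrite big_nat_recl //= eqxx mulr1n lerDl; apply: sumr_ge0 => *; exact: (@pn_ge0 _ _ _.+1).
elim: n z => [|n IH] z zD.
  have := sum_delta (fun=> 1) (uniq_int_range a b) zD.
  rewrite (eq_bigr (fun x => pn q 0 z x)) => [->|x _]; last by rewrite mulr1.
  by rewrite lerDl addr_ge0.
have [->|zb] := eqVneq z b%:Z.
  by have := sumD0 b%:Z n.+1; have := sum1 b%:Z n.+1; have := sum0 b%:Z (- a%:Z) n.+2; lra.
have [->|za] := eqVneq z (- a%:Z).
  by have := sumD0 (- a%:Z) n.+1; have := sum1 (- a%:Z) n.+1; have := sum0 (- a%:Z) b%:Z n.+2; lra.
have zR := zD; rewrite mem_int_range in zR.
have h1 : z + 1 \in int_range a b by rewrite mem_int_range; lia.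
have h2 : z - 1 \in int_range a b by rewrite mem_int_range; lia.
have := mix_le (q01 z) (IH _ h1) (IH _ h2).
rewrite !(pn_sumS _ n.+1) (negPf zb) (negPf za) !mulr0n !add0r.
have -> : \sum_(x <- int_range a b) pn q n.+1 z x =
    q z * (\sum_(x <- int_range a b) pn q n (z + 1) x)
    + (1 - q z) * (\sum_(x <- int_range a b) pn q n (z - 1) x).
  by rewrite !mulr_sumr -big_split.
rewrite !mulrDr !mulr1 addrC subrK => h; apply: le_trans h _.
by rewrite le_eqVlt; apply/orP; left; apply/eqP; ring.
Qed.

Lemma sum_pn_le_rev_measure q n x : prob_env q ->
  \sum_(0 <= k < n) pn q k 0 x <= n%:R * rev_measure q x.
Proof.
move=> q01; rewrite -[n in leRHS]subn0 mulr_natl -sumr_const_nat.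
apply: ler_sum => k _; have := pn_reversible k 0 x q01.
rewrite /= half_measure0 // mul1r => ->.
by rewrite ler_piMr ?pn_le1 // ltW // rev_measure_gt0.
Qed.

(** By reversibility the return probability at time [2 n] is at least the sum of
    [p_n(0, x)^2 / pi(x)] over the interval. By Cauchy-Schwarz this is at least the squared
    probability of being in the interval divided by its [pi]-mass. The first bound makes visits to
    the endpoints rare, so that probability is at least [1/2]; the second bounds the [pi]-mass. *)
Lemma return_ge q (a b n : nat) (B : R) : prob_env q ->
  n.+1%:R * (rev_measure q b%:Z + rev_measure q (- a%:Z)) <= 2^-1 ->
  (forall x, - a%:Z <= x <= b%:Z -> rev_measure q x <= B) ->
  (4 * ((a + b).+1%:R * B))^-1 <= pn q n.*2 0 0.
Proof.
move=> q01 he hB; pose D := int_range a b.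
have D0 : 0 \in D by rewrite mem_int_range; lia.
have s_ge : 2^-1 <= \sum_(x <- D) pn q n 0 x.
  have := pn_mass n q01 D0.
  have := sum_pn_le_rev_measure n.+1 b%:Z q01.
  have := sum_pn_le_rev_measure n.+1 (- a%:Z) q01.
  move: he; rewrite mulrDr -/D.
  move: (\sum_(x <- D) _) (\sum_(0 <= k < _) _) (\sum_(0 <= k < _) _) => s t u.
  by move=> *; lra.
have W_le : \sum_(x <- D) rev_measure q x <= (a + b).+1%:R * B.
  rewrite /D /int_range big_map -[X in iota 0 X]subn0 -/(index_iota 0 (a + b).+1).
  rewrite -[X in X%:R * _]subn0 mulr_natl.
  rewrite -sumr_const_nat; apply: ler_sum_nat => i i_lt; apply: hB; lia.
have W_gt0 : 0 < (a + b).+1%:R * B.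
  rewrite mulr_gt0 // (lt_le_trans (rev_measure_gt0 0 q01)) // hB //; lia.
set W := _ * B in W_le W_gt0 *.
rewrite -addnn; apply: le_trans (pn_chapman_ge n n 0 0 q01 (uniq_int_range a b)).
(* AM-GM: p^2 / pi >= 2 l p - l^2 pi with l = 1 / (2 W) *)
pose l := (2 * W)^-1.
apply: (@le_trans _ _ (2 * l * (\sum_(x <- D) pn q n 0 x) -
    l ^+ 2 * \sum_(x <- D) rev_measure q x)); last first.
  rewrite !mulr_sumr -sumrB; apply: ler_sum => x _.
  have h := rev_measure_gt0 x q01.
  have -> : pn q n 0 x = rev_measure q x * pn q n x 0.
    by rewrite pn_reversible //= half_measure0 // mul1r.
  rewrite -subr_ge0; set p := pn _ _ _ _; set m := rev_measure _ _ in h *.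
  have -> : m * p * p - (2 * l * (m * p) - l ^+ 2 * m) = m * (p - l) ^+ 2 by ring.
  by rewrite mulr_ge0 ?sqr_ge0 // ltW.
have l0 : 0 < l by rewrite invr_gt0 mulr_gt0.
apply: (@le_trans _ _ (2 * l * 2^-1 - l ^+ 2 * W)).
  have -> : (4 * W)^-1 = l / 2 by rewrite /l -invfM; congr (_^-1); ring.
  have -> : l ^+ 2 * W = l / 2 by rewrite /l; field; rewrite gt_eqF.
  by lra.
rewrite lerB // ler_wpM2l // ?exprn_ge0 ?mulr_ge0 // ltW //.
Qed.

End ReturnBounds.

(** * Return probabilities of the simple random walk *)

Section SimpleWalk.
Context (R : realType).
Implicit Types (n k : nat).

Definition srw_return n : R := pn (fun=> 2^-1) n.*2 0 0.

Lemma prob_env_half : prob_env (fun=> 2^-1 : R).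
Proof. by move=> x; lra. Qed.

Lemma pn_far (q : int -> R) n (x : int) : n%:Z < x -> pn q n x 0 = 0.
Proof.
elim: n x => [|n IH] x h /=; first by case: eqP => // e; exfalso; lia.
by rewrite !IH ?mulr0 ?addr0 //; lia.
Qed.

Lemma pn_binomial n k : pn (fun=> 2^-1 : R) n (n%:Z - k.*2%:Z) 0 = 'C(n, k)%:R / 2 ^+ n.
Proof.
elim: n k => [|n IH] [|k].
- by rewrite subrr /= divr1.
- by rewrite mul0r; apply: (congr1 (fun b : bool => b%:R : R) (y := false)); lia.

- rewrite double0 subr0 /= pn_far; last lia.
  have -> : n.+1%:Z - 1 = n%:Z - 0.*2%:Z by lia.
  by rewrite IH !bin0 exprS mulr0 add0r; field.
rewrite [LHS]/=.
have -> : n.+1%:Z - k.+1.*2%:Z + 1 = n%:Z - k.*2%:Z by lia.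
have -> : n.+1%:Z - k.+1.*2%:Z - 1 = n%:Z - k.+1.*2%:Z by lia.
by rewrite !IH binS natrD exprS; field.
Qed.

Lemma srw_return0 : srw_return 0 = 1. Proof. by []. Qed.

Lemma srw_returnE n : srw_return n = 'C(n.*2, n)%:R / 2 ^+ n.*2.
Proof. by rewrite -pn_binomial subrr. Qed.

Lemma srw_returnS n : srw_return n.+1 = srw_return n * ((n.*2.+1)%:R / (n.*2.+2)%:R).
Proof.
have e : (n.+1 * 'C(n.*2.+2, n.+1) = 2 * (n.*2.+1 * 'C(n.*2, n)))%N.
  rewrite -(mul_bin_diag n.*2.+2 n) -[n.*2.+2.-1]/(n.*2.+1).
  have := mul_bin_diag n.*2.+1 n => /=.
  have -> : 'C(n.*2.+1, n.+1) = 'C(n.*2.+1, n).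
    by rewrite -[RHS]bin_sub; [congr 'C(_, _); lia|lia].
  move=> e; rewrite e -doubleS; lia.
have {}e : n.+1%:R * 'C(n.*2.+2, n.+1)%:R = 2 * ((n.*2.+1)%:R * 'C(n.*2, n)%:R) :> R.
  by rewrite -!natrM e.
rewrite !srw_returnE doubleS 2!exprS.
have -> : (n.*2.+2)%:R = 2 * n.+1%:R :> R by rewrite -natrM; congr _%:R; lia.
have h0 : n.+1%:R != 0 :> R by rewrite pnatr_eq0.
have p0 : 2 ^+ n.*2 != 0 :> R by rewrite expf_neq0.
move: ('C(n.*2.+2, _)%:R) 'C(n.*2, n)%:R (n.*2.+1)%:R (n.+1%:R) (2 ^+ _) e h0 p0.
move=> a b c d p e d0 p0.
have -> : a = 2 * (c * b) / d by rewrite -e mulrC mulKf.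
by field; rewrite d0 p0.
Qed.

Lemma srw_return_gt0 n : 0 < srw_return n.
Proof. by elim: n => // n IH; rewrite srw_returnS mulr_gt0 ?divr_gt0. Qed.

(** The left side equals 1 at [n = 0] and is nonincreasing, since [(2n+1)(2n+3) <= (2n+2)^2]. *)
Lemma srw_return_le n : srw_return n ^+ 2 * n.*2.+1%:R <= 1.
Proof.
elim: n => [|n IH]; first by rewrite expr1n mul1r.
apply: le_trans IH; rewrite srw_returnS doubleS exprMn -mulrA ler_wpM2l ?sqr_ge0 //.
rewrite expr_div_n mulrAC ler_pdivrMr ?exprn_gt0 // -!natrX -!natrM ler_nat.
by rewrite !expnS !expn0; nia.
Qed.

(** The right side equals 1 at [n = 1] and is nondecreasing, since [4n(n+1) <= (2n+1)^2]. *)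
Lemma srw_return_ge n : (0 < n)%N -> 1 <= srw_return n ^+ 2 * (4 * n)%:R.
Proof.
elim: n => [//|[|n] IH] _.
  by rewrite srw_returnS srw_return0 double0 muln1 mul1r expr2; lra.
apply: le_trans (IH isT) _.
rewrite [in leRHS]srw_returnS exprMn -[leRHS]mulrA ler_wpM2l ?sqr_ge0 //.
rewrite expr_div_n mulrAC ler_pdivlMr ?exprn_gt0 // -!natrX -!natrM ler_nat.
by rewrite !expnS !expn0; nia.
Qed.

(* [u_n - u_(n+1) = u_n / (2 n + 2)] dominates [u_n ^ 3 / 2], so the sum
   telescopes. *)
Lemma srw_return_cube_sum n : \sum_(0 <= k < n) srw_return k ^+ 3 <= 2.
Proof.
suff : \sum_(0 <= k < n) srw_return k ^+ 3 <= 2 - 2 * srw_return n.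
  by move=> h; apply: le_trans h _; have := srw_return_gt0 n; lra.
elim: n => [|n IH]; first by rewrite big_geq // srw_return0; lra.
rewrite big_nat_recr //=; apply: le_trans (lerD IH (lexx _)) _.
rewrite srw_returnS; have := srw_return_gt0 n; have := srw_return_le n.
move: (srw_return n) => u.
have -> : n.*2.+2%:R = n.*2.+1%:R + 1 :> R by rewrite natr1.
have : 1 <= n.*2.+1%:R :> R by rewrite ler1n.
move: n.*2.+1%:R => c c1 h u0.
have c0 : 0 < c by lra.
have {}h : u ^+ 2 <= c^-1 by rewrite -[leRHS]mul1r ler_pdivlMr.
have h3 : u ^+ 3 <= u * c^-1 by rewrite exprS ler_wpM2l // ltW.
have c2 : c^-1 <= 2 * (1 - c / (c + 1)).
  have -> : 2 * (1 - c / (c + 1)) = 2 / (c + 1) by field; rewrite gt_eqF //; lra.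
  rewrite ler_pdivlMr; last lra.
  have ci1 : c^-1 <= 1 by rewrite invf_le1.
  by rewrite mulrDr mulVf ?gt_eqF //; lra.
have := ler_wpM2l (ltW u0) c2.
have -> : u * (2 * (1 - c / (c + 1))) = 2 * u - 2 * (u * (c / (c + 1))) by ring.
by move: (u * _) (u * _) h3 => s t; lra.
Qed.

End SimpleWalk.

(** * From bounds on partial sums to harmonic sums, along dyadic blocks *)

Section DyadicBlocks.
Context (R : realType).
Implicit Types (f : nat -> R) (n j t g : nat).

Lemma expR_half_le2 : expR 2^-1 <= 2 :> R.
Proof.
have : 1 + (- 2^-1) <= expR (- 2^-1) :> R by exact: expR_ge1Dx.
rewrite expRN => h; rewrite -[leRHS]invrK -[leLHS]invrK lef_pV2 ?posrE ?invr_gt0 ?expR_gt0 //.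
by apply: le_trans h; lra.
Qed.

Lemma expR_nat_le4 n : expR n%:R <= 4 ^+ n :> R.
Proof.
have -> : n%:R = n.*2%:R * 2^-1 :> R by rewrite -muln2 natrM; field.
rewrite expRM_natl -mul2n exprM -[4](_ : 2 ^+ 2 = 4 :> R); last by rewrite expr2; lra.
by rewrite !lerXn2r ?nnegrE ?expR_ge0 // ?exprn_ge0 ?expR_ge0 ?expR_half_le2.
Qed.

Lemma expR_nat_ge2 n : 2 ^+ n <= expR n%:R :> R.
Proof.
rewrite -[X in expR X]mulr1 expRM_natl lerXn2r ?nnegrE ?expR_ge0 //.
by have := expR_ge1Dx (1 : R); lra.
Qed.

Lemma leq_expn2 n : (n.+1 <= 2 ^ n)%N.
Proof. by elim: n => // n IH; rewrite expnS; lia. Qed.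

(** On the block [1 / k <= 2^-t], and the assumed bound is used at [n = 2^(t+1)]. Since
    [8 * g <= t], the factor [2^-t] absorbs [g^3 exp g] and leaves [g^-2 = 4^-j]; the linear term
    contributes [2 B / 4^j]. *)
Lemma dyadic_block_le f (B : R) g j t : (forall k, 0 <= f k) -> 0 <= B ->
  g = (2 ^ j)%N -> (8 * g <= t)%N ->
  (forall n, \sum_(0 <= m < n) f m <= B * (g%:R ^+ 3 * expR g%:R + n%:R / 4 ^+ j)) ->
  \sum_(2 ^ t <= k < 2 ^ t.+1) f k / k%:R <= 3 * B / 4 ^+ j.
Proof.
move=> f0 B0 gE gt hf.
have t0 : 0 < 2 ^+ t :> R by exact: exprn_gt0.
have g0 : 0 < g%:R :> R by rewrite ltr0n gE expn_gt0.
have g4 : g%:R ^+ 2 = 4 ^+ j :> R.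
  by rewrite gE natrX -exprM mulnC exprM; congr (_ ^+ _); rewrite expr2; lra.
apply: (@le_trans _ _ ((2 ^+ t)^-1 * \sum_(2 ^ t <= k < 2 ^ t.+1) f k)).
  rewrite mulr_sumr; apply: ler_sum_nat => k /andP[tk _].
  rewrite mulrC ler_wpM2r // lef_pV2 ?posrE ?t0 -?natrX ?ler_nat //.
  by rewrite ltr0n (leq_trans _ tk) // expn_gt0.
apply: (@le_trans _ _ ((2 ^+ t)^-1 * (B * (g%:R ^+ 3 * expR g%:R + (2 ^ t.+1)%:R / 4 ^+ j)))).
  rewrite ler_wpM2l ?invr_ge0 ?(ltW t0) //; apply: le_trans (hf _).
  rewrite [leRHS](big_cat_nat (n := (2 ^ t)%N)) //=; last by rewrite leq_exp2l.
  by rewrite lerDr; apply: sumr_ge0.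
rewrite -g4; have eg : expR g%:R <= 4 ^+ g :> R by exact: expR_nat_le4.
have h1 : g%:R ^+ 3 * expR g%:R / 2 ^+ t <= (g%:R ^+ 2)^-1 :> R.
  rewrite ler_pdivrMr // [leRHS]mulrC ler_pdivlMr ?exprn_gt0 //.
  apply: (@le_trans _ _ (g%:R ^+ 3 * 4 ^+ g * g%:R ^+ 2)).
    by apply: ler_wpM2r; rewrite ?exprn_ge0 //; apply: ler_wpM2l; rewrite ?exprn_ge0.
  rewrite -!natrX -!natrM ler_nat.
  have g2 : (g <= 2 ^ g)%N by exact: ltnW (leq_expn2 g).
  (* [g^5 <= 2^(5 g)] and [4^g = 2^(2 g)] give [2^(7 g)] in total. *)
  apply: (@leq_trans (2 ^ (8 * g))%N); last by rewrite leq_exp2l.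
  rewrite -[4%N]/(2 ^ 2)%N -expnM mulnAC -expnD.
  apply: (@leq_trans (2 ^ (g * 5) * 2 ^ (2 * g))%N); last by rewrite -expnD leq_exp2l //; lia.
  by rewrite leq_mul2r [(2 ^ (g * 5))%N]expnM leq_exp2r // g2 orbT.
rewrite natrX [2 ^+ t.+1]exprS; move: h1 t0 (exprn_gt0 2 g0).
move: (g%:R ^+ 3 * _) (2 ^+ t) (g%:R ^+ 2) => a b c h1 b0 c0.
have -> : b^-1 * (B * (a + 2 * b / c)) = B * (a / b) + 2 * B / c.
  by field; rewrite !gt_eqF.
have := ler_wpM2l B0 h1; have -> : 3 * B / c = B * c^-1 + 2 * B / c by field; rewrite gt_eqF.
lra.
Qed.

(** The bound of index [j] serves for [k] between [2^(8 * 2^j)] and [2^(8 * 2^(j+1))]. These are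
    [8 * 2^j] dyadic blocks, each contributing at most [3 B / 4^j], so together at most
    [24 B / 2^j], which is summable in [j]. *)
Lemma harmonic_sum_bounded f (B : R) j0 : (forall k, 0 <= f k) -> 0 <= B ->
  (forall j, (j0 <= j)%N -> forall n, \sum_(0 <= m < n) f m <=
     B * ((2 ^ j)%:R ^+ 3 * expR (2 ^ j)%:R + n%:R / 4 ^+ j)) ->
  exists K : R, forall n, \sum_(1 <= k < n) f k / k%:R <= K.
Proof.
move=> f0 B0 hf; pose b j := (2 ^ (8 * 2 ^ j))%N.
have fk0 k : 0 <= f k / k%:R by rewrite divr_ge0.
have b1 j : (0 < b j)%N by rewrite expn_gt0.
have block j s : (j0 <= j)%N ->
    \sum_(b j <= k < 2 ^ (8 * 2 ^ j + s)) f k / k%:R <= s%:R * (3 * B / 4 ^+ j).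
  move=> hj; elim: s => [|s IH]; first by rewrite addn0 big_geq // mul0r.
  rewrite (big_cat_nat (n := (2 ^ (8 * 2 ^ j + s))%N)) //=; first last.
  - by rewrite leq_exp2l // leq_add2l.
  - by rewrite leq_exp2l // leq_addr.
  rewrite -natr1 mulrDl mul1r lerD // addnS.
  by apply: (@dyadic_block_le _ _ (2 ^ j)%N) => //; [exact: leq_addr|exact: hf].
have bS j : (b j <= b j.+1)%N by rewrite leq_exp2l // leq_mul2l /= leq_exp2l.
have step j : (j0 <= j)%N -> \sum_(b j <= k < b j.+1) f k / k%:R <= 24 * B / 2 ^+ j.
  move=> hj; have := @block j (8 * 2 ^ j)%N hj.
  rewrite -[X in (2 ^ X)%N](_ : (8 * 2 ^ j.+1 = _)%N); last by rewrite expnS; lia.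
  move=> h; apply: le_trans h _; rewrite natrM natrX.
  have -> : 4 ^+ j = 2 ^+ j * 2 ^+ j :> R by rewrite -exprMn; congr (_ ^+ _); lra.
  rewrite le_eqVlt; apply/orP; left; apply/eqP; field.
  by rewrite expf_neq0.
pose K0 := \sum_(1 <= k < b j0) f k / k%:R.
(* The subtracted term is the tail of the series [24 B / 2^j] from [j0 + s] on, which makes the
   induction telescope. *)
have main s : \sum_(1 <= k < b (j0 + s)%N) f k / k%:R <= K0 + 48 * B - 48 * B / 2 ^+ (j0 + s).
  elim: s => [|s IH].
    rewrite addn0 -addrA lerDl subr_ge0 ler_pdivrMr ?exprn_gt0 // ler_peMr ?mulr_ge0 //.
    by rewrite exprn_ege1 // ler1n.
  rewrite addnS (big_cat_nat (n := b (j0 + s)%N)) //=.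
  apply: le_trans (lerD IH (step _ (leq_addr _ _))) _.
  rewrite exprS; have : 2 ^+ (j0 + s) != 0 :> R by rewrite expf_neq0.
  move: (2 ^+ _) => x x0.
  rewrite le_eqVlt; apply/orP; left; apply/eqP; field.
  by rewrite x0.
exists (K0 + 48 * B) => n.
have nb : (n <= b (j0 + n)%N)%N.
  apply: (leq_trans (ltnW (leq_expn2 n))); rewrite leq_exp2l //.
  apply: (leq_trans (ltnW (leq_expn2 n))).
  by rewrite -[X in (X <= _)%N]mul1n leq_mul // leq_exp2l // leq_addl.
have [n1|n1] := leqP n 1.
  rewrite big_geq // addr_ge0 ?mulr_ge0 //; exact: sumr_ge0.
apply: (@le_trans _ _ (\sum_(1 <= k < b (j0 + n)%N) f k / k%:R)).
  rewrite [leRHS](big_cat_nat (n := n)) //=; last exact: ltnW.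
  by rewrite lerDl; exact: sumr_ge0.
by apply: le_trans (main n) _; rewrite gerBl divr_ge0 // ?mulr_ge0 //.
Qed.

End DyadicBlocks.

Lemma even_sum_le (R : realType) (v : nat -> R) n : (forall k, 0 <= v k) ->
  \sum_(0 <= k < n) v k.*2 <= \sum_(0 <= k < n.*2) v k.
Proof.
move=> v0; elim: n => [|n IH]; first by rewrite !big_geq.
rewrite doubleS !big_nat_recr //; apply: le_trans (lerD IH (lexx _)) _.
by rewrite lerDl.
Qed.

(** * Return estimates in a uniformly elliptic environment *)

Section EllipticEnvironment.
Context (R : realType) (eps : R).
Hypothesis eps01 : 0 < eps < 2^-1.
Implicit Types (q : int -> R).

Definition elliptic q := forall x, eps <= q x <= 1 - eps.

Lemma elliptic_prob_env q : elliptic q -> prob_env q.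
Proof. by move=> eq x; have := eq x; move: eps01; lra. Qed.

Lemma elliptic_reflect q : elliptic q -> elliptic (reflect_env q).
Proof. by move=> eq x; have := eq (- x); rewrite /reflect_env; lra. Qed.

Lemma elliptic_inv q x : elliptic q -> (q x)^-1 <= eps^-1.
Proof.
move=> eq; have q01 := elliptic_prob_env eq x; have ex := eq x; move: eps01 => e01.
by rewrite lef_pV2 ?posrE //; lra.
Qed.

(** [green_le] at the site [k], with height [2^j]. The depth [2 (j + 1)] is chosen so that
    [exp(-2 (j + 1)) <= 4^-(j+1)]; the spare factor 4 covers the doubling of time. *)
Lemma even_green_le q (j k n : nat) : elliptic q -> (k <= (2 ^ j) ^ 3)%N ->
  potential q k <= - (2 * j.+1%:R) ->
  (forall l, (l < k)%N -> potential q l <= (2 ^ j)%:R) ->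
  \sum_(0 <= m < n) pn q m.*2 0 0 <=
    eps^-1 * ((2 ^ j)%:R ^+ 3 * expR (2 ^ j)%:R + n%:R / 4 ^+ j).
Proof.
move=> eq hk hVk hV; have q01 := elliptic_prob_env eq.
have /andP[e0 _] := eps01.
apply: le_trans (even_sum_le n (fun k => pn_ge0 k 0 0 q01)) _.
apply: le_trans (green_le k n.*2 q01) _.
have hs : \sum_(0 <= i < k) expR (potential q i) <= (2 ^ j)%:R ^+ 3 * expR (2 ^ j)%:R.
  apply: (@le_trans _ _ (k%:R * expR (2 ^ j)%:R)).
    rewrite mulr_natl -[k in leRHS]subn0 -sumr_const_nat.
    by apply: ler_sum_nat => i /andP[_ ik]; rewrite ler_expR hV.
  by rewrite ler_wpM2r ?expR_ge0 // -natrX ler_nat.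
have hn : n.*2%:R * expR (potential q k) <= n%:R / 4 ^+ j.
  apply: (@le_trans _ _ (n.*2%:R * (4 ^+ j.+1)^-1)).
    rewrite ler_wpM2l //; apply: (@le_trans _ _ (expR (- (2 * j.+1%:R)))).
      by rewrite ler_expR.
    rewrite expRN lef_pV2 ?posrE ?expR_gt0 ?exprn_gt0 //.
    have -> : 4 ^+ j.+1 = 2 ^+ (2 * j.+1) :> R.
      by rewrite exprM; congr (_ ^+ _); rewrite expr2; lra.
    by rewrite -natrM expR_nat_ge2.
  rewrite -muln2 natrM exprS.
  have : 0 <= n%:R / 4 ^+ j :> R by rewrite divr_ge0 ?exprn_ge0.
  have h4 : 4 ^+ j != 0 :> R by rewrite expf_neq0.
  have -> : n%:R * 2 / (4 * 4 ^+ j) = 2^-1 * (n%:R / 4 ^+ j) :> R by field.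
  by lra.
apply: ler_pM; rewrite ?invr_ge0 ?lerD //.
- by have := q01 0; lra.
- by rewrite addr_ge0 ?mulr_ge0 ?expR_ge0 // sumr_ge0 // => *; exact: expR_ge0.
- exact: elliptic_inv.
Qed.

(** One favourable side per scale is enough, and it may vary with the scale, because return
    probabilities to the origin are invariant under reflection. *)
Lemma harmonic_return_bounded q j0 : elliptic q ->
  (forall j, (j0 <= j)%N -> exists q', (q' = q \/ q' = reflect_env q) /\
     exists2 k, (k <= (2 ^ j) ^ 3)%N & potential q' k <= - (2 * j.+1%:R) /\
       forall l, (l < k)%N -> potential q' l <= (2 ^ j)%:R) ->
  exists K : R, forall n, \sum_(1 <= k < n) pn q k.*2 0 0 / k%:R <= K.
Proof.
move=> eq hj; have q01 := elliptic_prob_env eq; have /andP[e0 _] := eps01.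
apply: (harmonic_sum_bounded (B := eps^-1) (j0 := j0)).
- by move=> k; exact: pn_ge0.
- by rewrite invr_ge0 ltW.
move=> j /hj[q' [eq' [k hk [hVk hV]]]] n.
have -> : \sum_(0 <= m < n) pn q m.*2 0 0 = \sum_(0 <= m < n) pn q' m.*2 0 0.
  by case: eq' => ->//; apply: eq_bigr => m _; rewrite pn_reflect oppr0.
by apply: even_green_le hk hVk hV; case: eq' => -> //; exact: elliptic_reflect.
Qed.

Definition deep_valley q (delta : R) (h : nat) (B : nat) : Prop :=
  exists2 b, (b <= B)%N & 3 * h%:R <= potential q b /\
    forall m, (m < b)%N -> - (2 * delta * h%:R) <= potential q m.

Lemma half_measure_le q n : elliptic q -> half_measure q n <= eps^-1 * expR (- potential q n).
Proof.
move=> eq; rewrite /half_measure [leRHS]mulrC -mulrA ler_wpM2l ?expR_ge0 //.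
have q01 := elliptic_prob_env eq.
apply: le_trans (elliptic_inv n%:Z eq).
by rewrite ler_piMl ?invr_ge0; have := q01 0; have := q01 n%:Z; lra.
Qed.

(** [return_ge] on the interval between the two barriers. Height [3 h] gives the endpoints mass at
    most [8^-h / eps]; for [n <= 4^h] the expected number of visits to them is then at most
    [4 / (eps 2^h)], hence at most [1/2] once [h >= 8 / eps]. In the interval the mass is at most
    [exp(2 delta h) / eps]. *)
Lemma valley_return_ge q (delta : R) (h B n : nat) : elliptic q -> 0 <= delta ->
  (0 < h)%N -> 8 / eps <= h%:R ->
  deep_valley q delta h B -> deep_valley (reflect_env q) delta h B -> (n <= 4 ^ h)%N ->
  eps / (4 * (B.*2.+1)%:R) * expR (- (2 * delta * h%:R)) <= pn q n.*2 0 0.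
Proof.
move=> eq d0 h0 he [b bB [Vb hb]] [a aB [Va ha]] hn.
have q01 := elliptic_prob_env eq; have /andP[e0 _] := eps01.
have er := elliptic_reflect eq; have r01 := elliptic_prob_env er.
have dh : 0 <= 2 * delta * h%:R by rewrite !mulr_ge0.
have rbE : rev_measure q b%:Z = half_measure q b by [].
have raE : rev_measure q (- a%:Z) = half_measure (reflect_env q) a.
  by rewrite -rev_measure_reflect.
have side q' c : elliptic q' -> (forall m, (m < c)%N -> - (2 * delta * h%:R) <= potential q' m) ->
    3 * h%:R <= potential q' c -> forall m, (m <= c)%N ->
    half_measure q' m <= eps^-1 * expR (2 * delta * h%:R).
  move=> eq' lo hi m mc; apply: le_trans (half_measure_le m eq') _.
  rewrite ler_wpM2l ?invr_ge0 ?(ltW e0) // ler_expR lerNl.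
  move: mc; rewrite leq_eqVlt => /predU1P[->|/lo//].
  apply: le_trans hi; apply: (@le_trans _ _ 0); first by rewrite oppr_le0.
  by rewrite mulr_ge0.
have top q' c : elliptic q' -> 3 * h%:R <= potential q' c ->
    half_measure q' c <= eps^-1 * (8 ^+ h)^-1.
  move=> eq' hi; apply: le_trans (half_measure_le c eq') _.
  rewrite ler_wpM2l ?invr_ge0 ?(ltW e0) // expRN lef_pV2 ?posrE ?expR_gt0 ?exprn_gt0 //.
  have -> : 8 ^+ h = 2 ^+ (3 * h) :> R.
    by rewrite exprM; congr (_ ^+ _); rewrite !exprS expr0; lra.
  by apply: le_trans (expR_nat_ge2 _ _) _; rewrite ler_expR natrM.
have hB : forall x, - a%:Z <= x <= b%:Z -> rev_measure q x <= eps^-1 * expR (2 * delta * h%:R).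
  move=> [m|m] hx.
    by apply: (side q b) => //; lia.
  by apply: (side (reflect_env q) a) => //; lia.
have hsmall : n.+1%:R * (rev_measure q b%:Z + rev_measure q (- a%:Z)) <= 2^-1.
  have h4 : n.+1%:R <= 2 * 4 ^+ h :> R.
    rewrite -natr1; have : n%:R <= 4 ^+ h :> R by rewrite -natrX ler_nat.
    have : 1 <= 4 ^+ h :> R by rewrite exprn_ege1 // ler1n.
    lra.
  apply: (@le_trans _ _ (2 * 4 ^+ h * (eps^-1 * (8 ^+ h)^-1 + eps^-1 * (8 ^+ h)^-1))).
    apply: ler_pM => //; last by rewrite rbE raE lerD // top.
    by rewrite addr_ge0 // ltW // rev_measure_gt0.
  have -> : 8 ^+ h = 4 ^+ h * 2 ^+ h :> R by rewrite -exprMn; congr (_ ^+ _); lra.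
  have p4 : 4 ^+ h != 0 :> R by rewrite expf_neq0.
  have p2 : 2 ^+ h != 0 :> R by rewrite expf_neq0.
  have -> : 2 * 4 ^+ h * (eps^-1 * (4 ^+ h * 2 ^+ h)^-1 + eps^-1 * (4 ^+ h * 2 ^+ h)^-1)
      = (8 / eps / 2 ^+ h) / 2 by field; rewrite p2 p4 gt_eqF.
  rewrite ler_pdivrMr // mulVf // ler_pdivrMr ?exprn_gt0 // mul1r.
  apply: le_trans he _; rewrite -natrX ler_nat; exact: ltnW (leq_expn2 h).
apply: le_trans (return_ge q01 hsmall hB).
have -> : eps / (4 * (B.*2.+1)%:R) * expR (- (2 * delta * h%:R)) =
    (4 * ((B.*2.+1)%:R * (eps^-1 * expR (2 * delta * h%:R))))^-1.
  rewrite expRN; have := expR_gt0 (2 * delta * h%:R); move: (expR _) => E E0.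
  by field; rewrite !gt_eqF.
rewrite lef_pV2 ?posrE; last first.
- by rewrite !mulr_gt0 ?invr_gt0 ?expR_gt0.
- by rewrite !mulr_gt0 ?invr_gt0 ?expR_gt0.
rewrite ler_pM2l // ler_pM2r ?mulr_gt0 ?invr_gt0 ?expR_gt0 // ler_nat ltnS -addnn addnC.
by rewrite leq_add.
Qed.

Lemma srw_return_ge_pow h n : (0 < n <= 4 ^ h)%N -> (2 * 2 ^+ h)^-1 <= srw_return R n.
Proof.
move=> /andP[n0 nh]; have u0 := srw_return_gt0 R n; have := srw_return_ge R n0.
have : (4 * n)%:R <= (2 * 2 ^+ h) ^+ 2 :> R.
  rewrite natrM exprMn -[_ ^+ h ^+ 2]exprM mulnC exprM.
  have -> : 2 ^+ 2 = 4 :> R by rewrite expr2; lra.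
  by rewrite ler_wpM2l // -natrX ler_nat.
have p0 : 0 < 2 * 2 ^+ h :> R by rewrite mulr_gt0 ?exprn_gt0.
move: (srw_return R n) (2 * 2 ^+ h) u0 p0 => u p u0 p0 h1 h2.
rewrite -[leLHS]mul1r ler_pdivrMr //.
rewrite -(@ler_pXn2r _ 2) ?nnegrE ?mulr_ge0 ?(ltW u0) ?(ltW p0) // expr1n exprMn.
by apply: le_trans h2 _; rewrite ler_wpM2l ?sqr_ge0.
Qed.

Lemma expR_quarter_ge (N h : nat) : (0 < N)%N ->
  (h%:R / (4 * N%:R)) ^+ N <= expR (h%:R / 4) :> R.
Proof.
move=> N0; have -> : h%:R / 4 = N%:R * (h%:R / (4 * N%:R)) :> R.
  by field; rewrite pnatr_eq0 -lt0n.
have x0 : 0 <= h%:R / (4 * N%:R) :> R by rewrite divr_ge0 ?mulr_ge0.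
rewrite expRM_natl lerXn2r ?nnegrE ?expR_ge0 //.
by apply: le_trans (expR_ge1Dx _); rewrite lerDr.
Qed.

(** The simple walk contributes [4^h] terms of size at least [2^-h / 2], hence
    [2^h / 2 >= exp(h / 2) / 2]. The [r] environments cost [h^(-3 r) exp(-2 r delta h)] up to a
    constant, and [2 r delta <= 1/4]. The surplus [exp(h / 4)] beats [h^(3 r + 1)], which leaves a
    multiple of [h]. *)
Lemma product_return_sum_ge (r : nat) : exists2 c : R, 0 < c &
  forall (q : 'I_r -> int -> R) (h B : nat), (forall j, elliptic (q j)) ->
    (0 < h)%N -> 8 / eps <= h%:R -> (B <= 2 * h ^ 3)%N ->
    (forall j, deep_valley (q j) (8 * r.+1%:R)^-1 h B) ->
    (forall j, deep_valley (reflect_env (q j)) (8 * r.+1%:R)^-1 h B) ->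
    c * h%:R <= \sum_(1 <= n < (4 ^ h).+1) srw_return R n * \prod_j pn (q j) n.*2 0 0.
Proof.
have /andP[e0 _] := eps01.
(* The exponent [N] is one more than needed to cancel [h^(3 r)], so that a factor [h] remains. *)
pose N := (3 * r).+1; pose D : R := 2^-1 * (eps / 20) ^+ r * ((4 * N%:R) ^+ N)^-1.
have N0 : 0 < 4 * N%:R :> R by rewrite mulr_gt0 ?ltr0n.
exists D.
  by rewrite /D !mulr_gt0 ?invr_gt0 ?exprn_gt0 ?divr_gt0.
move=> q h B eq h0 he hB hr hl; pose delta : R := (8 * r.+1%:R)^-1.
have d0 : 0 < delta by rewrite invr_gt0 mulr_gt0.
(* [20 h^3] dominates [4 (2 B + 1)], because [B <= 2 h^3] and [h >= 1]. *)
pose p : R := eps / (20 * h%:R ^+ 3) * expR (- (2 * delta * h%:R)).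
have hR : 0 < h%:R :> R by rewrite ltr0n.
have p0 : 0 < p by rewrite mulr_gt0 ?expR_gt0 ?divr_gt0 ?mulr_gt0 ?exprn_gt0.
have p_le j n : (n <= 4 ^ h)%N -> p <= pn (q j) n.*2 0 0.
  move=> nh; apply: le_trans (valley_return_ge (eq j) (ltW d0) h0 he (hr j) (hl j) nh).
  rewrite ler_wpM2r ?expR_ge0 // ler_wpM2l ?(ltW e0) // lef_pV2 ?posrE ?mulr_gt0 ?exprn_gt0 //.
  rewrite -natrX -!natrM ler_nat; nia.
have term n : (0 < n <= 4 ^ h)%N ->
    (2 * 2 ^+ h)^-1 * p ^+ r <= srw_return R n * \prod_j pn (q j) n.*2 0 0.
  move=> hn; apply: ler_pM; first by rewrite invr_ge0 mulr_ge0 ?exprn_ge0.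
  - by rewrite exprn_ge0 // ltW.
  - exact: srw_return_ge_pow.
  rewrite -[r in p ^+ r]card_ord -prodr_const; apply: ler_prod => j _.
  by rewrite (ltW p0) p_le //; case/andP: hn.
apply: (@le_trans _ _ (\sum_(1 <= n < (4 ^ h).+1) (2 * 2 ^+ h)^-1 * p ^+ r)); last first.
  by apply: ler_sum_nat => n /andP[n0 nh]; apply: term; rewrite n0 -ltnS.
rewrite sumr_const_nat subSS subn0 -[leRHS]mulr_natl natrX.
have -> : 4 ^+ h = 2 ^+ h * 2 ^+ h :> R by rewrite -exprMn; congr (_ ^+ _); lra.
have -> : 2 ^+ h * 2 ^+ h * ((2 * 2 ^+ h)^-1 * p ^+ r) = 2^-1 * 2 ^+ h * p ^+ r.
  by field; rewrite expf_neq0.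
have two_h : expR (h%:R / 2) <= 2 ^+ h :> R.
  by rewrite expRM_natl lerXn2r ?nnegrE ?expR_ge0 // expR_half_le2.
have p_pow : (eps / 20) ^+ r * (h%:R ^+ (3 * r))^-1 * expR (- (h%:R / 4)) <= p ^+ r.
  have -> : p = eps / 20 * (h%:R ^+ 3)^-1 * expR (- (2 * delta * h%:R)).
    by rewrite /p invfM mulrA.
  rewrite (exprM _ 3 r) -exprVn [leRHS]exprMn [X in _ <= X * _]exprMn ler_wpM2l //.
    by rewrite mulr_ge0 ?exprn_ge0 ?invr_ge0 ?exprn_ge0 ?divr_ge0 ?(ltW e0).
  rewrite -expRM_natl ler_expR mulrN lerN2 /delta.
  have -> : r%:R * (2 * (8 * r.+1%:R)^-1 * h%:R) = (r%:R / r.+1%:R) * (h%:R / 4) :> R.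
    have : r.+1%:R != 0 :> R by rewrite pnatr_eq0.
    by move: (r%:R) (r.+1%:R) => x y y0; field.
  rewrite ler_piMl ?divr_ge0 // ler_pdivrMr // mul1r ler_nat //.
apply: (@le_trans _ _ (2^-1 * expR (h%:R / 2) *
    ((eps / 20) ^+ r * (h%:R ^+ (3 * r))^-1 * expR (- (h%:R / 4))))); last first.
  apply: ler_pM.
  - by apply: mulr_ge0; rewrite ?expR_ge0 ?invr_ge0.
  - by rewrite !mulr_ge0 ?expR_ge0 ?invr_ge0 ?exprn_ge0 ?divr_ge0 ?(ltW e0).
  - by rewrite ler_wpM2l ?invr_ge0.
  - exact: p_pow.
have -> : h%:R / 2 = h%:R / 4 + h%:R / 4 :> R by field.
rewrite expRD expRN /D.
have : h%:R * h%:R ^+ (3 * r) / (4 * N%:R) ^+ N <= expR (h%:R / 4) :> R.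
  by rewrite -exprS -expr_div_n; exact: expR_quarter_ge.
have : 0 < (4 * N%:R) ^+ N :> R by exact: exprn_gt0.
have : 0 < (eps / 20) ^+ r by rewrite exprn_gt0 ?divr_gt0.
have : 0 < h%:R ^+ (3 * r) :> R by exact: exprn_gt0.
have := expR_gt0 (h%:R / 4 : R).
move: ((eps / 20) ^+ r) ((4 * N%:R) ^+ N) (h%:R ^+ (3 * r)) (expR _) => x y z E E0 z0 x0 y0 hE.
have -> : 2^-1 * (E * E) * (x * z^-1 * E^-1) = 2^-1 * x * z^-1 * E by field; rewrite !gt_eqF.
apply: (@le_trans _ _ (2^-1 * x * z^-1 * (h%:R * z / y))).
  by rewrite le_eqVlt; apply/orP; left; apply/eqP; field; rewrite !gt_eqF.
by rewrite ler_wpM2l // !mulr_ge0 ?invr_ge0 ?(ltW z0) ?(ltW x0).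
Qed.

End EllipticEnvironment.

(** * Exit of a centred random walk from an interval *)

Section BoundedExpectation.
Context d (T : measurableType d) (R : realType) (P : probability T R).
Implicit Types (f g : T -> R).

Definition bounded_mfun f := measurable_fun setT f /\ exists K : R, forall w, `|f w| <= K.

Definition mean f : R := Rintegral P setT f.

Lemma bounded_mfun_integrable f : bounded_mfun f -> P.-integrable setT (EFin \o f).
Proof.
move=> [mf [K fK]]; apply: measurable_bounded_integrable => //.
  exact: le_lt_trans (probability_le1 P measurableT) (ltry 1).
exists K; split; first exact: num_real.
by move=> x Kx w _; apply: le_trans (fK w) _; exact: ltW.
Qed.

Lemma bounded_mfunD f g : bounded_mfun f -> bounded_mfun g ->
  bounded_mfun (fun w => f w + g w).
Proof.
move=> [mf [K fK]] [mg [L gL]]; split; first exact: measurable_funD.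
by exists (K + L) => w; rewrite (le_trans (ler_normD _ _)) // lerD.
Qed.

Lemma bounded_mfunM f g : bounded_mfun f -> bounded_mfun g ->
  bounded_mfun (fun w => f w * g w).
Proof.
move=> [mf [K fK]] [mg [L gL]]; split; first exact: measurable_funM.
by exists (K * L) => w; rewrite normrM ler_pM.
Qed.

Lemma bounded_mfun_cst (c : R) : bounded_mfun (fun=> c).
Proof. by split; [exact: measurable_cst|exists `|c|]. Qed.

Lemma bounded_mfun_indic (A : set T) : measurable A -> bounded_mfun (\1_A : T -> R).
Proof.
move=> mA; split; first exact: measurable_indic.
by exists 1 => w; rewrite indicE normr_nat lern1 leq_b1.
Qed.

Lemma meanD f g : bounded_mfun f -> bounded_mfun g ->
  mean (fun w => f w + g w) = mean f + mean g.
Proof. by move=> bf bg; rewrite /mean RintegralD //; exact: bounded_mfun_integrable. Qed.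

Lemma meanZ (c : R) f : bounded_mfun f -> mean (fun w => c * f w) = c * mean f.
Proof. by move=> bf; rewrite /mean RintegralZl //; exact: bounded_mfun_integrable. Qed.

Lemma mean_cst (c : R) : mean (fun=> c) = c.
Proof.
rewrite /mean Rintegral_cst // [X in fine X](_ : _ = 1%E) ?mulr1 //.
exact: probability_setT.
Qed.

Lemma le_mean f g : bounded_mfun f -> bounded_mfun g -> (forall w, f w <= g w) ->
  mean f <= mean g.
Proof.
by move=> bf bg fg; apply: le_Rintegral => //; exact: bounded_mfun_integrable.
Qed.

Lemma mean_indic (A : set T) : measurable A -> mean \1_A = fine (P A).
Proof. by move=> mA; rewrite /mean /Rintegral integral_indic // setIT. Qed.

Definition independent_rv f g := forall A B : set R, measurable A -> measurable B ->
  P (f @^-1` A `&` g @^-1` B) = (P (f @^-1` A) * P (g @^-1` B))%E.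

(** Independence identifies the joint law of [(f, g)] with the product of the two laws, by
    uniqueness of product measures; Tonelli then splits the integral. *)
Lemma ge0_integralM_independent f g : measurable_fun setT f -> measurable_fun setT g ->
  (forall w, 0 <= f w) -> (forall w, 0 <= g w) -> independent_rv f g ->
  (\int[P]_w (f w * g w)%:E = (\int[P]_w (f w)%:E) * (\int[P]_w (g w)%:E))%E.
Proof.
move=> mf mg f0 g0 fg.
pose mfm := isMeasurableFun.Build _ _ _ _ _ mf.
pose F : {mfun T >-> R} := HB.pack f mfm.
pose mgm := isMeasurableFun.Build _ _ _ _ _ mg.
pose G : {mfun T >-> R} := HB.pack g mgm.
have mphi : measurable_fun setT (fun w => (f w, g w)) by exact: measurable_fun_pair.
pose mphim := isMeasurableFun.Build _ _ _ _ _ mphi.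
pose Phi : {mfun T >-> (R * R)%type} := HB.pack (fun w => (f w, g w)) mphim.
(* Cutting off at 0 makes the integrand nonnegative on the whole plane and does not change it on the
   range of [(f, g)]. *)
pose h (z : R * R) : \bar R := (Num.max z.1 0 * Num.max z.2 0)%:E.
have mmax : measurable_fun setT (fun x : R => Num.max x 0).
  by apply: measurable_maxr => //; exact: measurable_cst.
have mh : measurable_fun setT h.
  apply/measurable_EFinP/measurable_funM.
    exact: (measurableT_comp mmax measurable_fst).
  exact: (measurableT_comp mmax measurable_snd).
have h0 z : (0 <= h z)%E by rewrite lee_fin mulr_ge0 // le_max lexx orbT.
transitivity (\int[distribution P Phi]_z h z)%E.
  rewrite ge0_integral_distribution //; apply: eq_integral => w _ /=.
  by rewrite /h /= !max_l.
transitivity (\int[(distribution P F \x distribution P G)%E]_z h z)%E.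
  apply: eq_measure_integral => A mA _; apply/esym.
  by apply: product_measure_unique mA => A1 B1 mA1 mB1; exact: fg.
rewrite fubini_tonelli1 //.
transitivity (\int[distribution P F]_x
   ((Num.max x 0)%:E * \int[distribution P G]_y (Num.max y 0)%:E))%E.
  apply: eq_integral => x _; rewrite /fubini_F /h /=.
  under eq_integral do rewrite EFinM.
  rewrite ge0_integralZl //.
  - exact/measurable_EFinP.
  - by move=> y _; rewrite lee_fin le_max lexx orbT.
  - by rewrite lee_fin le_max lexx orbT.
rewrite ge0_integralZr //; last first.
- by apply: integral_ge0 => y _; rewrite lee_fin le_max lexx orbT.
- by move=> y _; rewrite lee_fin le_max lexx orbT.
- exact/measurable_EFinP.
have distE (X : {mfun T >-> R}) : (forall w, 0 <= X w) ->
    (\int[distribution P X]_y (Num.max y 0)%:E = \int[P]_w (X w)%:E)%E.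
  move=> X0; rewrite (@ge0_integral_distribution _ _ _ _ _ P X (fun y => (Num.max y 0)%:E)).
  - by apply: eq_integral => w _ /=; rewrite max_l.
  - exact/measurable_EFinP.
  - by move=> y; rewrite lee_fin le_max lexx orbT.
by rewrite !distE.
Qed.

Lemma mean_fin f : bounded_mfun f -> (mean f)%:E = (\int[P]_w (f w)%:E)%E.
Proof.
move=> bf; rewrite /mean /Rintegral fineK //.
exact: (integrable_fin_num measurableT (bounded_mfun_integrable bf)).
Qed.

(** Adding the bounds [K] and [L] makes both factors nonnegative; linearity then removes the
    shifts. *)
Lemma meanM f g : bounded_mfun f -> bounded_mfun g -> independent_rv f g ->
  mean (fun w => f w * g w) = mean f * mean g.
Proof.
move=> bf bg fg; have [mf [K fK]] := bf; have [mg [L gL]] := bg.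
have bK := bounded_mfun_cst K; have bL := bounded_mfun_cst L.
have bfK := bounded_mfunD bf bK; have bgL := bounded_mfunD bg bL.
have : mean (fun w => (f w + K) * (g w + L)) = mean (fun w => f w + K) * mean (fun w => g w + L).
  apply: EFin_inj; rewrite EFinM !mean_fin //; last exact: bounded_mfunM.
  apply: ge0_integralM_independent bfK.1 bgL.1 _ _ _.
  - by move=> w; have := fK w; rewrite ler_norml => /andP[]; lra.
  - by move=> w; have := gL w; rewrite ler_norml => /andP[]; lra.
  - move=> A B mA mB.
    have mshift (c : R) : measurable_fun setT (fun x : R => x + c).
      by apply: measurable_funD; [exact: measurable_id|exact: measurable_cst].
    apply: (fg ((fun x => x + K) @^-1` A) ((fun x => x + L) @^-1` B)).
      by rewrite -[X in measurable X]setTI; exact: mshift.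
    by rewrite -[X in measurable X]setTI; exact: mshift.
rewrite !meanD // !mean_cst.
have -> : mean (fun w => (f w + K) * (g w + L)) =
    mean (fun w => f w * g w) + (L * mean f + (K * mean g + K * L)).
{ rewrite -[X in _ + (_ + (_ + X))]mean_cst -!meanZ // -!meanD //.
  - by congr mean; apply/funext => w; ring.
  all: repeat (apply: bounded_mfunD || apply: bounded_mfunM); try exact: bounded_mfun_cst.
  all: by []. }
by rewrite mulrDl !mulrDr => h; move: h; move: (mean _) (mean f) (mean g) => a b c; lra.
Qed.

End BoundedExpectation.

(** * Measurability with respect to a generated sigma-algebra *)

Section SubSigmaAlgebra.
Context d (T : measurableType d) (R : realType).
Implicit Types (S : set (set T)) (f : T -> R).

Definition mfun_wrt S f := measurable_fun setT (f : g_sigma_algebraType S -> R).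

Lemma mfun_wrt_preimage S f (B : set R) : mfun_wrt S f -> measurable B -> <<s S >> (f @^-1` B).
Proof. by move=> mf mB; rewrite -[X in <<s S >> X]setTI; exact: mf. Qed.

Lemma mfun_wrtS S S' f : S `<=` S' -> mfun_wrt S f -> mfun_wrt S' f.
Proof.
move=> SS' mf _ B mB; have := mf measurableT B mB.
by apply: sub_smallest2r.
Qed.

Lemma mfun_wrt_measurable S f : S `<=` measurable -> mfun_wrt S f -> measurable_fun setT f.
Proof.
move=> Sm mf _ B mB; have := mf measurableT B mB.
by apply: smallest_sub; [exact: sigma_algebra_measurable|].
Qed.

Lemma mfun_wrt_self f (S : set (set T)) :
  preimage_set_system setT f measurable `<=` S -> mfun_wrt S f.
Proof.
by move=> fS _ B mB; apply: sub_gen_smallest; apply: fS; exists B.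
Qed.

End SubSigmaAlgebra.

(** * Optional stopping for bounded centred steps *)

Section ExitOfInterval.
Context d (T : measurableType d) (R : realType) (P : probability T R).
Variables (X : nat -> T -> R) (C s2 : R).

Definition past (n : nat) : set (set T) :=
  \bigcup_(i in [set i | (i < n)%N]) preimage_set_system setT (X i) measurable.

Hypothesis mX : forall n, measurable_fun setT (X n).
Hypothesis X_bd : forall n w, `|X n w| <= C.
Hypothesis X_mean : forall n, mean P (X n) = 0.
Hypothesis X_var : forall n, mean P (fun w => X n w ^+ 2) = s2.
Hypothesis X_indep : forall n (E : set T) (B : set R), <<s past n >> E -> measurable B ->
  P (E `&` X n @^-1` B) = (P E * P (X n @^-1` B))%E.

Definition partial_sum n w : R := \sum_(0 <= i < n) X i w.

Variables (a H : R).
Hypothesis (a0 : 0 < a) (H0 : 0 < H).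

(* The partial sums, frozen from the first exit of [(-a, H)] onwards. *)
Fixpoint stopped n : T -> R :=
  if n is n'.+1 then
    fun w => stopped n' w + \1_[set v | - a < stopped n' v < H] w * X n' w
  else fun=> 0.

Definition alive n := [set w | - a < stopped n w < H].

Definition exits_above n := [set w | exists2 k, (k <= n)%N &
  H <= partial_sum k w /\ forall l, (l < k)%N -> - a < partial_sum l w].

Definition exits_below n := [set w | exists2 k, (k <= n)%N &
  partial_sum k w <= - a /\ forall l, (l < k)%N -> partial_sum l w < H].

Lemma stoppedS n w : stopped n.+1 w = stopped n w + \1_(alive n) w * X n w.
Proof. by []. Qed.

Lemma stopped_trichotomy n w :
  [/\ alive n w -> stopped n w = partial_sum n w /\
                   forall k, (k <= n)%N -> - a < partial_sum k w < H,
      H <= stopped n w -> exits_above n w &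
      stopped n w <= - a -> exits_below n w].
Proof.
elim: n => [|n [IH1 IH2 IH3]].
  have V0 : partial_sum 0 w = 0 by rewrite /partial_sum big_geq.
  split => [_|h|h].
  - split; first by rewrite V0.
    by move=> [|//] _; rewrite V0; move: a0 H0; lra.
  - by move: H0; rewrite ltNge; move: h => /= ->.
  - by have := le_trans (h : 0 <= - a) (lexx _); rewrite oppr_ge0 leNgt a0.
have VS : partial_sum n.+1 w = partial_sum n w + X n w.
  by rewrite /partial_sum big_nat_recr.
rewrite stoppedS indicE; have [|nal] := pselect (alive n w).
  move=> /[dup] /IH1[e V] al; rewrite mem_set // mul1r e -VS.
  split.
  - rewrite /alive /= indicE mem_set // mul1r e -VS => h; split => // k.
    by rewrite leq_eqVlt => /predU1P[->//|]; exact: V.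
  - move=> h; exists n.+1 => //; split => // l ln.
    by have /andP[] := V l ln.
  - move=> h; exists n.+1 => //; split => // l ln.
    by have /andP[] := V l ln.
rewrite memNset // mul0r addr0; split.
- by rewrite /alive /= indicE memNset // mul0r addr0 => /nal.
- by move=> /IH2[k kn h]; exists k => //; exact: leqW.
- by move=> /IH3[k kn h]; exists k => //; exact: leqW.
Qed.

(** The exit overshoots the interval by at most one step. *)
Lemma stopped_bound n w : - (a + C) <= stopped n w <= H + C.
Proof.
have C0 : 0 <= C by apply: le_trans (X_bd 0 w).
elim: n => [|n IH] /=; first by move: a0 H0; lra.
have := X_bd n w; rewrite ler_norml => h.
rewrite indicE; case: (boolP (w \in _)) => [/set_mem /= al|_].
  by move: a0 H0 al h IH; rewrite mul1r; move: (stopped n w) (X n w) => x y; lra.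
by rewrite mul0r addr0.
Qed.

Lemma pastS n : past n `<=` past n.+1.
Proof. by move=> E [i /= ni h]; exists i => //=; exact: leqW. Qed.

Lemma past_measurable n : past n `<=` measurable.
Proof. by move=> E [i _ [B mB <-]]; exact: mX. Qed.

Lemma alive_preimage n : alive n = stopped n @^-1` `]- a, H[%classic.
Proof. by apply/seteqP; split => w /=; rewrite in_itv. Qed.

Lemma stopped_past n : mfun_wrt (past n) (stopped n).
Proof.
elim: n => [|n IH]; first exact: measurable_cst.
apply: (@measurable_funD _ (g_sigma_algebraType (past n.+1))).
  by change (mfun_wrt (past n.+1) (stopped n)); exact: (mfun_wrtS (@pastS n)) IH.
apply: measurable_funM.
  apply: measurable_indic; rewrite -/(alive n) alive_preimage.
  by apply: mfun_wrt_preimage; [exact: (mfun_wrtS (@pastS n)) IH|exact: measurable_itv].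
by apply: mfun_wrt_self => E h; exists n => //=.
Qed.

Lemma alive_past n : <<s past n >> (alive n).
Proof.
by rewrite alive_preimage; apply: (mfun_wrt_preimage (@stopped_past n)); exact: measurable_itv.
Qed.

Lemma measurable_alive n : measurable (alive n).
Proof.
have := @alive_past n; apply: smallest_sub => //; first exact: sigma_algebra_measurable.
exact: past_measurable.
Qed.

Lemma bounded_stopped n : bounded_mfun (stopped n).
Proof.
split; first exact: (mfun_wrt_measurable (@past_measurable n)) (@stopped_past n).
exists (a + H + C) => w; have := stopped_bound n w; rewrite ler_norml.
by have : 0 <= C by [exact: le_trans (X_bd 0 w)]; move: a0 H0; lra.
Qed.

Lemma bounded_X n : bounded_mfun (X n).
Proof. by split; [exact: mX|exists C]. Qed.

Lemma independent_rv_X n (f : T -> R) : mfun_wrt (past n) f -> independent_rv P f (X n).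
Proof.
by move=> mf A B mA mB; rewrite X_indep //; exact: mfun_wrt_preimage.
Qed.

Let alive_wrt n : mfun_wrt (past n) (\1_(alive n) : T -> R).
Proof. by apply: measurable_indic; exact: alive_past. Qed.

(** Whether step [n] is taken is decided by the past, of which the centred variable [X n] is
    independent. *)
Lemma mean_stopped n : mean P (stopped n) = 0.
Proof.
have b1 k := bounded_mfun_indic R (measurable_alive k).
elim: n => [|n IH]; first exact: mean_cst.
rewrite meanD.
- rewrite IH add0r meanM ?X_mean ?mulr0 //; [exact: b1|exact: bounded_X|exact: independent_rv_X].
- exact: bounded_stopped.
- exact: bounded_mfunM (b1 n) (bounded_X n).
Qed.

(** Wald's second identity: the sum is the expected number of steps taken before time [n], and the
    cross terms vanish by independence from the past. *)
Lemma mean_stopped_sqr n :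
  mean P (fun w => stopped n w ^+ 2) = s2 * \sum_(0 <= k < n) fine (P (alive k)).
Proof.
have b1 k := bounded_mfun_indic R (measurable_alive k).
have bX := bounded_X; have bM := bounded_stopped.
elim: n => [|n IH].
  by rewrite big_geq // mulr0 /= expr0n; exact: mean_cst.
have b2 k : bounded_mfun (fun w => X k w ^+ 2) by exact: bounded_mfunM.
have bMsq k : bounded_mfun (fun w => stopped k w ^+ 2) by exact: bounded_mfunM.
have bMa k : bounded_mfun (fun w => stopped k w * \1_(alive k) w) by exact: bounded_mfunM.
transitivity (mean P (fun w => stopped n w ^+ 2 +
   (2 * ((stopped n w * \1_(alive n) w) * X n w) + \1_(alive n) w * X n w ^+ 2))).
  congr mean; apply/funext => w; rewrite stoppedS indicE.
  by case: (w \in _) => /=; ring.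
rewrite meanD //; last first.
  apply: bounded_mfunD; last exact: bounded_mfunM.
  by apply: bounded_mfunM; [exact: bounded_mfun_cst|exact: bounded_mfunM].
rewrite meanD; [| |exact: bounded_mfunM]; last first.
  by apply: bounded_mfunM; [exact: bounded_mfun_cst|exact: bounded_mfunM].
rewrite meanZ; last exact: bounded_mfunM.
have -> : mean P (fun w => stopped n w * \1_(alive n) w * X n w) = 0.
  rewrite (meanM (f := fun w => stopped n w * \1_(alive n) w)) ?X_mean ?mulr0 //.
  by apply: independent_rv_X; exact: (measurable_funM (@stopped_past n)) (@alive_wrt n).
have -> : mean P (fun w => \1_(alive n) w * X n w ^+ 2) = fine (P (alive n)) * s2.
  rewrite (meanM (f := \1_(alive n)) (g := fun w => X n w ^+ 2)) ?X_var //.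
    by rewrite mean_indic //; exact: measurable_alive.
  move=> A B mA mB.
  have msq : measurable ((fun x : R => x ^+ 2) @^-1` B).
    by rewrite -[X in measurable X]setTI; exact: exprn_measurable.
  exact: (X_indep (mfun_wrt_preimage (@alive_wrt n) mA) msq).
by rewrite IH big_nat_recr //=; ring.
Qed.

Definition above n := [set w | H <= stopped n w].
Definition below n := [set w | stopped n w <= - a].

Lemma above_past n : <<s past n >> (above n).
Proof.
have -> : above n = stopped n @^-1` `[H, +oo[%classic.
  by apply/seteqP; split => w /=; rewrite in_itv /= andbT.
by apply: (mfun_wrt_preimage (@stopped_past n)); exact: measurable_itv.
Qed.

Lemma below_past n : <<s past n >> (below n).
Proof.
have -> : below n = stopped n @^-1` `]-oo, - a]%classic.
  by apply/seteqP; split => w /=; rewrite in_itv.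
by apply: (mfun_wrt_preimage (@stopped_past n)); exact: measurable_itv.
Qed.

Lemma past_sigma_measurable n (E : set T) : <<s past n >> E -> measurable E.
Proof.
apply: smallest_sub => //; first exact: sigma_algebra_measurable.
exact: past_measurable.
Qed.

Let pr (E : set T) := fine (P E).

Let pr_fin (E : set T) : measurable E -> P E \is a fin_num.
Proof. by move=> mE; exact: fin_num_measure. Qed.

Lemma alive_antitone k n : (k <= n)%N -> alive n `<=` alive k.
Proof.
elim: n => [|n IH]; first by rewrite leqn0 => /eqP ->.
rewrite leq_eqVlt => /predU1P[-> //|kn].
apply: subset_trans (IH kn) => w; rewrite {1}/alive /= indicE.
case: (boolP (w \in _)) => [/set_mem //|_].
by rewrite mul0r addr0.
Qed.

Lemma prob_alive n : s2 * n%:R * pr (alive n) <= (a + H + C) ^+ 2.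
Proof.
have s2_ge0 : 0 <= s2.
  by rewrite -(X_var 0); apply: Rintegral_ge0 => w _; exact: sqr_ge0.
apply: (@le_trans _ _ (s2 * \sum_(0 <= k < n) pr (alive k))).
  rewrite -mulrA ler_wpM2l // mulr_natl -[n in _ *+ n]subn0 -sumr_const_nat.
  apply: ler_sum_nat => k /andP[_ kn]; rewrite fine_le ?pr_fin ?le_measure ?inE //;
    try exact: measurable_alive.
  by apply: alive_antitone; exact: ltnW.
rewrite -mean_stopped_sqr -[leRHS](mean_cst P); apply: le_mean.
- by apply: bounded_mfunM; exact: bounded_stopped.
- exact: bounded_mfun_cst.
move=> w; have := stopped_bound n w.
have : 0 <= C by exact: le_trans (X_bd 0 w).
move: a0 H0; move: (stopped n w) => x ha hH hC hx.
by rewrite -subr_ge0 subr_sqr mulr_ge0 //; lra.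
Qed.

(** Markov's inequality for the nonnegative variable [stopped n + a + C], whose mean is [a + C]. *)
Lemma prob_above_le n : pr (above n) <= (a + C) / H.
Proof.
have mA := past_sigma_measurable (@above_past n).
have b1 := bounded_mfun_indic R mA; have bM := bounded_stopped n.
rewrite ler_pdivlMr // mulrC /pr -mean_indic // -(meanZ _ _ b1).
have <- : mean P (fun w => stopped n w + (a + C)) = a + C.
  by rewrite meanD ?mean_stopped ?add0r ?mean_cst //; exact: bounded_mfun_cst.
apply: le_mean; first by apply: bounded_mfunM => //; exact: bounded_mfun_cst.
  by apply: bounded_mfunD => //; exact: bounded_mfun_cst.
move=> w; have := stopped_bound n w; rewrite indicE.
have C0 : 0 <= C by exact: le_trans (X_bd 0 w).
case: (boolP (w \in _)) => [/set_mem h|_].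
  have {}h : H <= stopped n w := h.
  by move: a0 h C0; rewrite mulr1; move: (stopped n w) => x *; lra.
by rewrite mulr0; move: (stopped n w) => x *; lra.
Qed.

Lemma prob_not_below n : (0 < n)%N -> 0 < s2 ->
  pr (~` below n) <= (a + C) / H + (a + H + C) ^+ 2 / (s2 * n%:R).
Proof.
move=> n0 s0; have mA := past_sigma_measurable (@above_past n).
have mB := past_sigma_measurable (@below_past n).
have mL := measurable_alive n.
apply: (@le_trans _ _ (pr (above n) + pr (alive n))); last first.
  rewrite lerD ?prob_above_le // ler_pdivlMr ?mulr_gt0 ?ltr0n //.
  by rewrite mulrC prob_alive.
rewrite /pr -fineD ?pr_fin // fine_le ?fin_numD ?pr_fin //; first exact: measurableC.
apply: (le_trans _ (measureU2 P mA mL)); rewrite le_measure ?inE //.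
- exact: measurableC.
- exact: measurableU.
move=> w /= /negP; rewrite -ltNge => h; have [Hs|Hs] := leP H (stopped n w); first by left.
by right; apply/andP.
Qed.

(** The variable [stopped n + a] has mean [a], is at most [a + H + C], and is positive only on
    [above n] or [alive n]. *)
Lemma prob_above_ge n : (0 < n)%N -> 0 < s2 ->
  a <= (a + H + C) * (pr (above n) + (a + H + C) ^+ 2 / (s2 * n%:R)).
Proof.
move=> n0 s0; have mA := past_sigma_measurable (@above_past n).
have mL := measurable_alive n.
have b1 := bounded_mfun_indic R mA; have b2 := bounded_mfun_indic R mL.
have bM := bounded_stopped n; have bc := bounded_mfun_cst T.
have C0 : 0 <= C by exact: le_trans (X_bd 0 point).
have K0 : 0 < a + H + C by move: a0 H0; lra.
apply: (@le_trans _ _ ((a + H + C) * (pr (above n) + pr (alive n)))); last first.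
  rewrite ler_wpM2l ?(ltW K0) // lerD2l ler_pdivlMr ?mulr_gt0 ?ltr0n //.
  by rewrite mulrC prob_alive.
rewrite /pr -!mean_indic // -meanD // -meanZ; last exact: bounded_mfunD.
have e : mean P (fun w => stopped n w + a) = a.
  by rewrite meanD // mean_stopped add0r mean_cst.
rewrite -[leLHS]e.
apply: le_mean; first exact: bounded_mfunD.
  by apply: bounded_mfunM => //; exact: bounded_mfunD.
move=> w; have := stopped_bound n w; rewrite !indicE.
case: (boolP (w \in above n)) => [_|/negP hA].
  have : 0 <= (w \in alive n)%:R :> R by [].
  move: K0 C0 a0 H0; rewrite mulr1n; move: (_%:R) (stopped n w) => x y K0 *.
  have hz : 0 <= (a + H + C) * x by exact: mulr_ge0 (ltW K0) _.
  by rewrite mulrDr; lra.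
case: (boolP (w \in alive n)) => [/set_mem /andP[_ h]|/negP hL] _.
  by move: h C0; rewrite mulr0n add0r mulr1; move: (stopped n w) => x *; lra.
rewrite mulr0n addr0 mulr0.
have h1 : ~ H <= stopped n w by move=> h; apply: hA; exact: mem_set.
move/negP: h1; rewrite -ltNge => h1.
have [h2|h2] := leP (stopped n w) (- a).
  by move: (stopped n w) h2 => x *; lra.
by exfalso; apply: hL; apply/mem_set/andP.
Qed.

End ExitOfInterval.

(** * Independence and the random environment *)

Section Grouping.
Context d (T : measurableType d) (R : realType) (P : probability T R).
Variables (A : choiceType) (G : A -> set (set T)).
Implicit Types (D : set A).

Definition sigma_join D : set (set T) := <<s \bigcup_(a in D) G a >>.

Lemma sigma_join_sub D D' : D `<=` D' -> sigma_join D `<=` sigma_join D'.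
Proof. by move=> DD'; apply: sub_sigma_algebra2 => E [a Da GE]; exists a => //; exact: DD'. Qed.

Hypothesis G_measurable : forall a, G a `<=` measurable.

Lemma sigma_join_measurable D E : sigma_join D E -> measurable E.
Proof.
apply: smallest_sub; first exact: sigma_algebra_measurable.
by move=> {}E [a _]; exact: G_measurable.
Qed.

Hypothesis G_setI : forall a, setI_closed (G a).
Hypothesis G_setT : forall a, G a setT.
Hypothesis G_indep : independent P G.

Lemma independent_seq (s : seq A) (B : A -> set T) : uniq s ->
  (forall a, a \in s -> G a (B a)) ->
  P (\bigcap_(a in [set` s]) B a) = (\prod_(a <- s) P (B a))%E.
Proof.
move=> us GB; pose J := [fset a in s]%fset.
have Js a : (a \in J) = (a \in s) by rewrite inE.
have -> : \bigcap_(a in [set` s]) B a = \bigcap_(a in [set` J]) B a.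
  by apply/seteqP; split => w h a /= aJ; apply: h; rewrite /= ?Js // -Js.
rewrite G_indep; last by move=> a; rewrite Js; exact: GB.
by apply: perm_big; apply: uniq_perm => //; exact: fset_uniq.
Qed.

(** Finite intersections with one event per index: the generating class on which the assumed
    independence can be read off directly. *)
Let pi_system D := [set C | exists (s : seq A) (B : A -> set T),
  [/\ uniq s, forall a, a \in s -> D a /\ G a (B a) & C = \bigcap_(a in [set` s]) B a]].

Let pi_system_setI D : setI_closed (pi_system D).
Proof.
move=> _ _ [s1 [B1 [u1 h1 ->]]] [s2 [B2 [u2 h2 ->]]].
(* Padding with [setT] lets both families be indexed by the union of the two lists. *)
pose E1 a := if a \in s1 then B1 a else setT.
pose E2 a := if a \in s2 then B2 a else setT.
exists (undup (s1 ++ s2)), (fun a => E1 a `&` E2 a); split; first exact: undup_uniq.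
  move=> a; rewrite mem_undup mem_cat => h; split.
    by case/orP: h => [/h1[]|/h2[]].
  apply: G_setI; rewrite /E1 /E2; case: ifPn => // ?; first exact: (h1 _ _).2.
  exact: (h2 _ _).2.
apply/seteqP; split => w.
  move=> [w1 w2] a _; rewrite /E1 /E2; split.
    by case: ifPn => // ?; exact: w1.
  by case: ifPn => // ?; exact: w2.
move=> h; split => a /= as_.
  have : [set` undup (s1 ++ s2)] a by rewrite /= mem_undup mem_cat as_.
  by move=> /h[]; rewrite /E1 as_.
have : [set` undup (s1 ++ s2)] a by rewrite /= mem_undup mem_cat as_ orbT.
by move=> /h[_]; rewrite /E2 as_.
Qed.

Let pi_system_setT D : pi_system D setT.
Proof.
exists [::], (fun=> setT); split => //.
by apply/seteqP; split => w.
Qed.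

Let pi_system_measurable D : pi_system D `<=` measurable.
Proof.
move=> _ [s [B [us h ->]]]; rewrite bigcap_seq big_seq.
by apply: bigsetI_measurable => a /h[_]; exact: G_measurable.
Qed.

Let sigma_join_pi D : sigma_join D `<=` <<s pi_system D >>.
Proof.
apply: sub_sigma_algebra2 => E [a Da GE]; exists [:: a], (fun=> E); split => //.
  by move=> b; rewrite inE => /eqP ->.
apply/seteqP; split => w; first by move=> Ew b.
by move=> /(_ a); apply; rewrite /= inE.
Qed.

(** In [E], both sides are finite measures agreeing on a pi-system that contains the whole space, so
    they agree on the generated sigma-algebra. *)
Let independent_extend (Pi : set (set T)) (F : set T) : Pi `<=` measurable ->
  setI_closed Pi -> Pi setT -> measurable F ->
  (forall E, Pi E -> P (E `&` F) = (P E * P F)%E) ->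
  forall E, <<s Pi >> E -> P (E `&` F) = (P E * P F)%E.
Proof.
move=> Pim PiI PiT mF hPi E sE.
have PF : P F \is a fin_num by exact: fin_num_measure.
pose r : {nonneg R} := NngNum (fine_ge0 (measure_ge0 P F)).
have mscaleE X : mscale r P X = (P X * P F)%E by rewrite /mscale /= fineK // muleC.
rewrite -mscaleE.
apply: (g_sigma_algebra_measure_unique Pi Pim (fun=> setT) _ _ (mrestr P mF) (mscale r P)) => //.
- by rewrite bigcup_const.
- by move=> X PiX; transitivity (P X * P F)%E; [exact: hPi|exact/esym/mscaleE].
- move=> _; apply: le_lt_trans (ltry 1); apply: probability_le1; exact: measurableI.
Qed.

(** The extension is applied to [F] with [E] fixed, then to [E] with [F] in its pi-system. What is
    left is a pair of finite intersections over disjoint lists, which concatenate. *)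
Theorem independent_disjoint_joins D1 D2 E F : D1 `&` D2 = set0 ->
  sigma_join D1 E -> sigma_join D2 F -> P (E `&` F) = (P E * P F)%E.
Proof.
move=> D0 sE sF.
have mE := sigma_join_measurable sE.
rewrite setIC muleC.
apply: (independent_extend (Pi := pi_system D2)); last exact: sigma_join_pi.
- exact: pi_system_measurable.
- exact: pi_system_setI.
- exact: pi_system_setT.
- exact: mE.
move=> {sF} {}F piF; rewrite setIC muleC.
apply: (independent_extend (Pi := pi_system D1)); last exact: sigma_join_pi.
- exact: pi_system_measurable.
- exact: pi_system_setI.
- exact: pi_system_setT.
- exact: (pi_system_measurable piF).
move=> {sE mE} _ [s1 [B1 [u1 h1 ->]]]; move: piF => [s2 [B2 [u2 h2 ->]]].
have dis a : a \in s1 -> a \in s2 -> False.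
  move=> /h1[D1a _] /h2[D2a _].
  by have : (D1 `&` D2) a by []; rewrite D0.
pose B a := if a \in s1 then B1 a else B2 a.
have eB1 a : a \in s1 -> B a = B1 a by rewrite /B => ->.
have eB2 a : a \in s2 -> B a = B2 a.
  by rewrite /B => as2; case: ifPn => // as1; case: (dis a).
have us : uniq (s1 ++ s2).
  rewrite cat_uniq u1 u2 andbT /=; apply/hasPn => a as2.
  by apply/negP => as1; exact: (dis a).
have eB : \bigcap_(a in [set` s1]) B1 a `&` \bigcap_(a in [set` s2]) B2 a =
    \bigcap_(a in [set` s1 ++ s2]) B a.
  apply/seteqP; split => w.
    move=> [w1 w2] a /=; rewrite mem_cat => /orP[as1|as2].
      by rewrite eB1 //; exact: w1.
    by rewrite eB2 //; exact: w2.
  move=> h; split => a /= as_.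
    by rewrite -eB1 //; apply: h; rewrite /= mem_cat as_.
  by rewrite -eB2 //; apply: h; rewrite /= mem_cat as_ orbT.
rewrite eB independent_seq //; last first.
  move=> a; rewrite mem_cat => /orP[as1|as2].
    by rewrite eB1 //; exact: (h1 _ _).2.
  by rewrite eB2 //; exact: (h2 _ _).2.
rewrite !independent_seq //; [|by move=> a /h2[]|by move=> a /h1[]].
rewrite big_cat /=; congr (_ * _)%E; apply: eq_big_seq => a as_.
  by rewrite eB1.
by rewrite eB2.
Qed.

End Grouping.

(** * First Borel-Cantelli lemma with bounded partial sums *)

Section BorelCantelli.
Context d (T : measurableType d) (R : realType) (P : probability T R).

Lemma borel_cantelli_bounded (F : nat -> set T) (M : R) :
  (forall n, measurable (F n)) ->
  (forall n, \sum_(0 <= k < n) fine (P (F k)) <= M) ->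
  {ae P, forall w, exists n0, forall n, (n0 <= n)%N -> ~ F n w}.
Proof.
move=> mF hM.
have fin_sum : (\sum_(k <oo) P (F k) < +oo)%E.
  apply: (@le_lt_trans _ _ M%:E); last exact: ltry.
  apply: lime_le; first by apply: is_cvg_nneseries => n _ _; exact: measure_ge0.
  apply: nearW => n; rewrite (eq_bigr (fun k => (fine (P (F k)))%:E)); last first.
    by move=> k _; rewrite fineK // fin_num_measure.
  by rewrite sumEFin lee_fin.
exists (lim_sup_set F); split.
- by apply: bigcapT_measurable => n; exact: bigcup_measurable.
- exact: lim_sup_set_cvg0.
move=> w /= h n _; apply: contrapT => hn; apply: h; exists n => k nk Fk.
by apply: hn; exists k.
Qed.

End BorelCantelli.

Lemma sqr_le_expn2 j : (j.+1 ^ 2 <= 4 * 2 ^ j)%N.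
Proof.
elim: j => // -[|[|j]] // IH; rewrite [(2 ^ j.+3)%N]expnS -mulnn; move: IH.
by rewrite -mulnn; move: (2 ^ j.+2)%N => x; nia.
Qed.

Lemma prodr_seq_const (R : realType) (L : Type) (s : seq L) (x : R) :
  \prod_(l <- s) x = x ^+ size s.
Proof. by elim: s => [|l s IH]; rewrite ?big_nil ?expr0 // big_cons IH exprS. Qed.

(** * Almost sure behaviour of the random potential *)

Section RandomEnvironment.
Context d (Om : measurableType d) (R : realType) (P : probability Om R).
Variables (I : nat) (om : 'I_I -> int -> {RV P >-> R}) (eps : R).
Hypothesis om01 : forall i x w, 0 < om i x w < 1.
Hypothesis om_iid : forall i, iid (om i).
Hypothesis om_indep : independent P (fun i => sigma_of (om i)).
Hypothesis eps01 : 0 < eps < 2^-1.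
Hypothesis om_elliptic : forall i, P [set w | eps <= om i 0 w <= 1 - eps] = 1%E.
Hypothesis om_rec : forall i, ('E_P[(fun w => ln (rho (om i 0 w)))%R] = 0)%E.
Hypothesis om_var : forall i, (0 < 'E_P[(fun w => ln (rho (om i 0 w)) ^+ 2)%R])%E.

Definition site_sigma (p : 'I_I * int) : set (set Om) :=
  g_sigma_algebra_preimage (om p.1 p.2).

Lemma site_sigma_measurable p : site_sigma p `<=` measurable.
Proof. by move=> E [B mB <-]; exact: measurable_funP. Qed.

Lemma site_sigma_setI p : setI_closed (site_sigma p).
Proof.
move=> _ _ [A mA <-] [B mB <-]; exists (A `&` B); first exact: measurableI.
by rewrite !setTI.
Qed.

Lemma site_sigma_setT p : site_sigma p setT.
Proof. by exists setT => //; rewrite setTI. Qed.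

(** The finite index set is split by environment: independence between environments factors over the
    first coordinate, independence of sites within each over the second. *)
Lemma site_sigma_independent : independent P site_sigma.
Proof.
move=> J B hB.
pose s i := [seq p.2 | p <- J & p.1 == i].
have memS i x : (x \in s i) = ((i, x) \in J).
  apply/mapP/idP => [[[i' x']]|h].
    by rewrite mem_filter /= => /andP[/eqP -> h] ->.
  by exists (i, x) => //; rewrite mem_filter eqxx.
have us i : uniq (s i).
  rewrite map_inj_in_uniq ?filter_uniq ?fset_uniq // => -[i1 x1] [i2 x2].
  by rewrite !mem_filter /= => /andP[/eqP -> _] /andP[/eqP -> _] ->.
pose C i := \bigcap_(x in [set` s i]) B (i, x).
have -> : \bigcap_(p in [set` J]) B p = \bigcap_(i in [set` enum 'I_I]) C i.
  apply/seteqP; split => w h.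
    by move=> i _ x /= xs; apply: h; rewrite /= -memS.
  by move=> [i x] /= iJ; apply: (h i); rewrite /= ?mem_enum // memS.
have hC i : sigma_of (om i) (C i).
  rewrite /C bigcap_seq big_seq.
  apply: (@bigsetI_measurable _ (g_sigma_algebraType _)) => x xs.
  by apply: sub_sigma_algebra; exists x => //; apply: (hB (i, x)); rewrite -memS.
rewrite (independent_seq om_indep) ?enum_uniq //.
transitivity (\prod_(i <- enum 'I_I) \prod_(p <- J | p.1 == i) P (B p))%E.
  apply: eq_bigr => i _; have [ind _] := om_iid i.
  rewrite /C (independent_seq ind (us i)); last first.
    by move=> x xs; apply: (hB (i, x)); rewrite -memS.
  rewrite big_map big_filter; apply: eq_bigr => -[i' x'] /= /eqP ->//.
rewrite big_enum /=; apply/esym.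
by rewrite (partition_big (fun p : 'I_I * int => p.1) predT).
Qed.

Lemma distribution_site i x (A : set R) : measurable A ->
  P (om i x @^-1` A) = P (om i 0 @^-1` A).
Proof. by move=> mA; have [_ /(_ x A mA)] := om_iid i. Qed.

Let elliptic_set : set R := `[eps, 1 - eps]%classic.

Let elliptic_setE a : elliptic_set a = (eps <= a <= 1 - eps).
Proof. by rewrite /elliptic_set /= in_itv. Qed.

Lemma site_elliptic i x : P (~` (om i x @^-1` elliptic_set)) = 0%E.
Proof.
have mE : measurable elliptic_set by exact: measurable_itv.
have mX : measurable (om i x @^-1` elliptic_set) by exact: measurable_funPTI.
rewrite probability_setC // distribution_site //.
have -> : om i 0 @^-1` elliptic_set = [set w | eps <= om i 0 w <= 1 - eps].
  by apply/seteqP; split => w; move: (elliptic_setE (om i 0 w)) => /= ->.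
by rewrite om_elliptic subee.
Qed.

Lemma ae_elliptic : {ae P, forall w, forall i, elliptic eps (fun x => om i x w)}.
Proof.
(* The pairs of an environment and a site are countable, so the exceptional null sets can be
   enumerated; codes of no pair give the empty set. *)
pose F n : set Om := if @choice.unpickle ('I_I * int)%type n is Some p
  then ~` (om p.1 p.2 @^-1` elliptic_set) else set0.
have : P.-negligible (\bigcup_n F n).
  apply: negligible_bigcup => n; rewrite /F.
  case: (choice.unpickle n) => [p|]; last exact: negligible_set0.
  exists (~` (om p.1 p.2 @^-1` elliptic_set)); split => //; last exact: site_elliptic.
  by apply: measurableC; apply: measurable_funPTI; exact: measurable_itv.
apply: negligibleS => w /= h.
apply: contrapT => nF; apply: h => i x.
apply: contrapT => ne; apply: nF; exists (choice.pickle (i, x)) => //.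
by rewrite /F choice.pickleK => h; apply: ne; move: h; rewrite -elliptic_setE.
Qed.

(** Bounded for every [a], as the stopping estimates require, and equal to [ln (rho a)] on the
    elliptic range, hence almost surely at each site. *)
Definition truncated_log (a : R) : R := \1_elliptic_set a * (ln (1 - a) - ln a).

Lemma ln_rho (a : R) : 0 < a < 1 -> ln (rho a) = ln (1 - a) - ln a.
Proof. by move=> /andP[a0 a1]; rewrite /rho ln_div ?posrE ?subr_gt0. Qed.

Lemma truncated_logE (a : R) : eps <= a <= 1 - eps -> truncated_log a = ln (rho a).
Proof.
move=> ha; have /andP[e0 _] := eps01.
rewrite /truncated_log indicE mem_set ?elliptic_setE // mul1r ln_rho //.
by apply/andP; move: ha; lra.
Qed.

Lemma measurable_truncated_log : measurable_fun setT truncated_log.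
Proof.
apply: measurable_funM; first by apply: measurable_indic; exact: measurable_itv.
apply: measurable_funB; last exact: measurable_ln.
apply: (measurableT_comp (@measurable_ln R)).
by apply: measurable_funB; [exact: measurable_cst|exact: measurable_id].
Qed.

Lemma truncated_log_bound (a : R) : `|truncated_log a| <= - ln eps.
Proof.
have /andP[e0 e1] := eps01.
have C0 : 0 <= - ln eps by rewrite oppr_ge0 ln_le0 //; lra.
rewrite /truncated_log indicE; case: (boolP (a \in _)) => [/set_mem|_]; last first.
  by rewrite mul0r normr0.
rewrite elliptic_setE mul1r => /andP[ea ae1].
have h1 : ln eps <= ln a by rewrite ler_ln ?posrE //; lra.
have h2 : ln eps <= ln (1 - a) by rewrite ler_ln ?posrE //; lra.
have h3 : ln a <= 0 by rewrite ln_le0 //; lra.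
have h4 : ln (1 - a) <= 0 by rewrite ln_le0 //; lra.
by rewrite ler_norml; move: h1 h2 h3 h4; lra.
Qed.

Definition site_log i x w := truncated_log (om i x w).

Lemma measurable_site_log i x : measurable_fun setT (site_log i x).
Proof. exact: (measurableT_comp measurable_truncated_log). Qed.

Lemma mean_site (h : R -> R) i x : measurable_fun setT h -> (exists K : R, forall a, `|h a| <= K) ->
  mean P (fun w => h (om i x w)) = mean P (fun w => h (om i 0 w)).
Proof.
move=> mh [K hK].
have bh y : bounded_mfun (fun w => h (om i y w)).
  by split; [exact: (measurableT_comp mh)|exists K].
have mh' : measurable_fun setT (EFin \o h) by exact/measurable_EFinP.
apply: EFin_inj; rewrite !mean_fin //.
have e y := @integral_distribution _ _ _ _ _ P (om i y) (EFin \o h) mh'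
  (bounded_mfun_integrable P (bh y)).
rewrite -(e x) -(e 0).
by apply: eq_measure_integral => A mA _; exact: distribution_site.
Qed.

Let ae_site0 i : {ae P, forall w, eps <= om i 0 w <= 1 - eps}.
Proof. by apply: filterS ae_elliptic => w /(_ i 0). Qed.

Let measurable_ln_rho i : measurable_fun setT (fun w => ln (rho (om i 0 w))).
Proof.
have -> : (fun w => ln (rho (om i 0 w))) = (fun w => ln (1 - om i 0 w) - ln (om i 0 w)).
  by apply/funext => w; rewrite ln_rho.
apply: measurable_funB.
  apply: (measurableT_comp (@measurable_ln R)).
  by apply: measurable_funB; [exact: measurable_cst|].
exact: (measurableT_comp (@measurable_ln R)).
Qed.

Lemma mean_site_log i x : mean P (site_log i x) = 0.
Proof.
rewrite /site_log mean_site; first last.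
- by exists (- ln eps); exact: truncated_log_bound.
- exact: measurable_truncated_log.
rewrite /mean /Rintegral (ae_eq_integral (fun w => (ln (rho (om i 0 w)))%:E)) //.
- by have := om_rec i; rewrite unlock => ->.
- apply/measurable_EFinP; exact: (measurable_site_log i 0).
- by apply/measurable_EFinP; exact: measurable_ln_rho.
- by apply: filterS (ae_site0 i) => w h _; rewrite truncated_logE.
Qed.

Definition site_var i := mean P (fun w => site_log i 0 w ^+ 2).

Lemma mean_site_log_sqr i x : mean P (fun w => site_log i x w ^+ 2) = site_var i.
Proof.
apply: (@mean_site (fun a => truncated_log a ^+ 2)).
  by apply: measurable_funX; exact: measurable_truncated_log.
exists ((- ln eps) ^+ 2) => a; rewrite normrX.
by rewrite lerXn2r ?nnegrE // ?(le_trans _ (truncated_log_bound a)) // truncated_log_bound.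
Qed.

Lemma site_var_gt0 i : 0 < site_var i.
Proof.
have bs : bounded_mfun (site_log i 0).
  split; first exact: measurable_site_log.
  by exists (- ln eps) => w; exact: truncated_log_bound.
rewrite -lte_fin mean_fin; last exact: bounded_mfunM.
have := om_var i; rewrite unlock.
rewrite (ae_eq_integral (fun w => (site_log i 0 w ^+ 2)%:E)) //.
- by apply/measurable_EFinP; apply: measurable_funX; exact: measurable_ln_rho.
- by apply/measurable_EFinP; apply: measurable_funX; exact: measurable_site_log.
- by apply: filterS (ae_site0 i) => w h _; rewrite /site_log truncated_logE.
Qed.

Local Notation sigma_sites := (sigma_join site_sigma).

(** Index [m] stands for the site at distance [m + 1] on side [b]; the origin lies on neither
    side. *)
Definition site (b : bool) (m : nat) : int := if b then m.+1%:Z else - m.+1%:Z.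

Definition side_env (b : bool) (q : int -> R) := if b then q else reflect_env q.

Definition step i b (K n : nat) (w : Om) : R :=
  (if b then 1 else -1) * site_log i (site b (K + n)) w.

Definition block i b (K n : nat) : set ('I_I * int) :=
  [set p | p.1 = i /\ exists2 l, (l < n)%N & p.2 = site b (K + l)].

Lemma sigma_sites_measurable D E : sigma_sites D E -> measurable E.
Proof. exact: (sigma_join_measurable site_sigma_measurable). Qed.

Lemma sigma_sites_independent D1 D2 E F : D1 `&` D2 = set0 ->
  sigma_sites D1 E -> sigma_sites D2 F -> P (E `&` F) = (P E * P F)%E.
Proof.
apply: independent_disjoint_joins.
- exact: site_sigma_measurable.
- exact: site_sigma_setI.
- exact: site_sigma_setT.
- exact: site_sigma_independent.
Qed.

Lemma site_inj b : injective (site b).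
Proof. by move=> m n; rewrite /site; case: b => h; lia. Qed.

Lemma step_site_sigma i b K n (B : set R) : measurable B ->
  site_sigma (i, site b (K + n)) (step i b K n @^-1` B).
Proof.
move=> mB; exists ((fun a => (if b then 1 else -1) * truncated_log a) @^-1` B).
  rewrite -[X in measurable X]setTI.
  by apply: measurable_funM => //; exact: measurable_truncated_log.
by rewrite setTI.
Qed.

Lemma past_block i b K n : <<s past (step i b K) n >> `<=` sigma_sites (block i b K n).
Proof.
apply: sub_sigma_algebra2 => _ [l /= ln [B mB <-]].
exists (i, site b (K + l)); first by split => //; exists l.
by rewrite setTI; exact: step_site_sigma.
Qed.

Lemma measurable_step i b K n : measurable_fun setT (step i b K n).
Proof. by apply: measurable_funM => //; exact: measurable_site_log. Qed.

Lemma step_bound i b K n w : `|step i b K n w| <= - ln eps.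
Proof.
by rewrite /step normrM; case: b; rewrite ?normrN normr1 mul1r; exact: truncated_log_bound.
Qed.

Lemma mean_step i b K n : mean P (step i b K n) = 0.
Proof.
rewrite /step meanZ; last first.
  by split; [exact: measurable_site_log|exists (- ln eps) => w; exact: truncated_log_bound].
by rewrite mean_site_log ?mulr0.
Qed.

Lemma mean_step_sqr i b K n : mean P (fun w => step i b K n w ^+ 2) = site_var i.
Proof.
rewrite -(mean_site_log_sqr i (site b (K + n))); congr mean; apply/funext => w.
by rewrite /step exprMn; case: b; rewrite ?sqrrN expr1n mul1r.
Qed.

Lemma step_indep i b K n E (B : set R) : <<s past (step i b K) n >> E -> measurable B ->
  P (E `&` step i b K n @^-1` B) = (P E * P (step i b K n @^-1` B))%E.
Proof.
move=> /past_block sE mB.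
apply: (sigma_sites_independent (D1 := block i b K n) (D2 := [set (i, site b (K + n))])) => //.
  apply/seteqP; split => // p [[_ [l ln e]]] /= ep.
  by move: e; rewrite ep /= => /site_inj /addnI nl; rewrite nl ltnn in ln.
by apply: sub_gen_smallest; exists (i, site b (K + n)) => //; exact: step_site_sigma.
Qed.

Lemma partial_sum_step i b K n w : elliptic eps (fun x => om i x w) ->
  partial_sum (step i b K) n w =
  potential (side_env b (fun x => om i x w)) (K + n) -
  potential (side_env b (fun x => om i x w)) K.
Proof.
move=> ell; elim: n => [|n IH].
  by rewrite /partial_sum big_geq // addn0 subrr.
rewrite /partial_sum big_nat_recr //= -/(partial_sum _ n w) IH addnS potentialS.
rewrite [RHS]addrAC; congr (_ + _); rewrite /step /site_log truncated_logE //.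
rewrite /side_env /site; case: b {IH}; first by rewrite mul1r.
rewrite mulN1r /reflect_env !ln_rho //; first by rewrite opprB subKr.
by have := om01 i (- (K + n).+1%:Z) w; lra.
Qed.

Local Notation above_step i b K a H n := (above (step i b K) a H n).
Local Notation below_step i b K a H n := (below (step i b K) a H n).

Lemma prob_not_below_step i b K (a H : R) n : 0 < a -> 0 < H -> (0 < n)%N ->
  fine (P (~` below_step i b K a H n)) <=
  (a - ln eps) / H + (a + H - ln eps) ^+ 2 / (site_var i * n%:R).
Proof.
move=> a0 H0 n0.
exact: (prob_not_below (measurable_step i b K) (step_bound i b K) (mean_step i b K)
  (mean_step_sqr i b K) (@step_indep i b K) a0 H0 n0 (site_var_gt0 _)).
Qed.

Lemma prob_above_step i b K (a H : R) n : 0 < a -> 0 < H -> (0 < n)%N ->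
  a <= (a + H - ln eps) * (fine (P (above_step i b K a H n)) +
    (a + H - ln eps) ^+ 2 / (site_var i * n%:R)).
Proof.
move=> a0 H0 n0.
exact: (prob_above_ge (measurable_step i b K) (step_bound i b K) (mean_step i b K)
  (mean_step_sqr i b K) (@step_indep i b K) a0 H0 n0 (site_var_gt0 _)).
Qed.

Lemma above_step_block i b K a H n : sigma_sites (block i b K n) (above_step i b K a H n).
Proof. by apply: past_block; exact: above_past. Qed.

Lemma below_step_block i b K a H n : sigma_sites (block i b K n) (below_step i b K a H n).
Proof. by apply: past_block; exact: below_past. Qed.

(** With [a = 2 (j + 1)], [H = 2^j] and [8^j] steps, the chance of rising first is of order
    [(j + 1) / 2^j], and that of not having left the interval of order [4^j / 8^j], which is no
    larger. *)
Let scale_not_below i (j : nat) (C := - ln eps) :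
  (2 * j.+1%:R + C) / (2 ^ j)%:R +
    (2 * j.+1%:R + (2 ^ j)%:R + C) ^+ 2 / (site_var i * ((2 ^ j) ^ 3)%:R)
  <= (2 + C + (3 + C) ^+ 2 / site_var i) * (j.+1%:R / (2 ^ j)%:R).
Proof.
have s0 : 0 < site_var i by exact: site_var_gt0.
have C0 : 0 <= C by apply: le_trans (truncated_log_bound 0).
rewrite [((2 ^ j) ^ 3)%:R]natrX; have jg : j.+1%:R <= (2 ^ j)%:R :> R by rewrite ler_nat leq_expn2.
have j1 : 1 <= j.+1%:R :> R by rewrite ler1n.
move: (site_var i) (2 ^ j)%:R j.+1%:R s0 jg j1 => s g x s0 xg x1.
have g1 : 1 <= g by exact: le_trans xg.
have g0 : 0 < g by lra.
have g0' := ltW g0; have x0 : 0 <= x by lra.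
have -> : (2 + C + (3 + C) ^+ 2 / s) * (x / g) =
  (2 + C) * x / g + (3 + C) ^+ 2 * x / (s * g) by field; rewrite !gt_eqF.
apply: lerD.
  rewrite ler_pM2r ?invr_gt0 //.
  by rewrite [leRHS]mulrDl lerD2l -[leLHS]mulr1 ler_wpM2l.
have -> : (3 + C) ^+ 2 * x / (s * g) = ((3 + C) * g) ^+ 2 * x / (s * g ^+ 3).
  by field; rewrite !gt_eqF.
rewrite ler_pM2r ?invr_gt0 ?mulr_gt0 ?exprn_gt0 //.
apply: (@le_trans _ _ (((3 + C) * g) ^+ 2)).
  apply: lerXn2r; rewrite ?nnegrE.
  - by rewrite !addr_ge0 // mulr_ge0.
  - by rewrite mulr_ge0 // addr_ge0.
  have h : C <= C * g by rewrite -[leLHS]mulr1 ler_wpM2l.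
  rewrite [leRHS]mulrDl; apply: lerD => //; lra.
by rewrite -[leLHS]mulr1 ler_wpM2l ?sqr_ge0.
Qed.

Theorem ae_harmonic_return_bounded i : {ae P, forall w, exists K : R, forall n,
  \sum_(1 <= k < n) pn (fun x => om i x w) k.*2 0 0 / k%:R <= K}.
Proof.
pose a j : R := 2 * j.+1%:R.
pose H j : R := (2 ^ j)%:R.
pose n j := ((2 ^ j) ^ 3)%N.
pose nb b j := ~` below_step i b 0%N (a j) (H j) (n j).
pose bad j := nb true j `&` nb false j.
have a0 j : 0 < a j by rewrite mulr_gt0.
have H0 j : 0 < H j by rewrite ltr0n expn_gt0.
have n0 j : (0 < n j)%N by rewrite !expn_gt0.
have nb_block b j : sigma_join site_sigma (block i b 0 (n j)) (nb b j).
  by apply: sigma_algebraC; exact: below_step_block.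
have mnb b j : measurable (nb b j) by exact: sigma_sites_measurable (nb_block b j).
pose C := - ln eps; pose K0 := 2 + C + (3 + C) ^+ 2 / site_var i.
have C0 : 0 <= C by apply: le_trans (truncated_log_bound 0).
have K00 : 0 <= K0.
  rewrite !addr_ge0 // divr_ge0 ?sqr_ge0 // ltW //; exact: site_var_gt0.
(* The two sides use disjoint sites, so the failure probability is a product, of order
   [(j + 1)^2 / 4^j]; [sqr_le_expn2] absorbs the polynomial factor. *)
have bad_le j : fine (P (bad j)) <= 4 * K0 ^+ 2 / 2 ^+ j.
  have -> : P (bad j) = (P (nb true j) * P (nb false j))%E.
    apply: (sigma_sites_independent _ (nb_block _ _) (nb_block _ _)).
    apply/seteqP; split => // -[i' x'] [[_ [l _ /= ->]] [_ [l' _ /=]]].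
    by lia.
  rewrite fineM ?fin_num_measure //.
  have nb_le b : fine (P (nb b j)) <= K0 * (j.+1%:R / H j).
    apply: le_trans (scale_not_below i j).
    exact: (prob_not_below_step i b 0).
  apply: (@le_trans _ _ ((K0 * (j.+1%:R / H j)) * (K0 * (j.+1%:R / H j)))).
    by apply: ler_pM; rewrite ?fine_ge0.
  have -> : (K0 * (j.+1%:R / H j)) * (K0 * (j.+1%:R / H j)) =
      K0 ^+ 2 * (j.+1%:R ^+ 2 / (H j * H j)) by field; rewrite gt_eqF.
  have -> : 4 * K0 ^+ 2 / 2 ^+ j = K0 ^+ 2 * (4 / 2 ^+ j) by rewrite [4 * _]mulrC mulrA.
  rewrite ler_wpM2l ?sqr_ge0 // /H natrX.
  rewrite ler_pdivrMr ?mulr_gt0 ?exprn_gt0 // mulrA divfK ?expf_neq0 //.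
  by rewrite -!natrX -natrM ler_nat sqr_le_expn2.
have bad_sum k : \sum_(0 <= j < k) fine (P (bad j)) <= 8 * K0 ^+ 2.
  apply: (@le_trans _ _ (8 * K0 ^+ 2 - 8 * K0 ^+ 2 / 2 ^+ k)); last first.
    by rewrite gerBl divr_ge0 ?mulr_ge0 ?sqr_ge0 ?exprn_ge0.
  elim: k => [|k IH]; first by rewrite big_geq // expr0 divr1 subrr.
  rewrite big_nat_recr //=; apply: le_trans (lerD IH (bad_le k)) _.
  have p0 : 2 ^+ k != 0 :> R by rewrite expf_neq0.
  by rewrite [2 ^+ k.+1]exprS le_eqVlt; apply/orP; left; apply/eqP; field.
have BC := borel_cantelli_bounded (fun j => measurableI _ _ (mnb true j) (mnb false j)) bad_sum.
have EL := ae_elliptic.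
apply: filterS2 BC EL => w [j0 hj0] /(_ i) ell.
apply: (harmonic_return_bounded eps01 (j0 := j0) ell) => j /hj0 nbad.
have {nbad} [b hb] : exists b, below_step i b 0%N (a j) (H j) (n j) w.
  apply: contrapT => h; apply: nbad; split => hb; apply: h.
    by exists true.
  by exists false.
exists (side_env b (fun x => om i x w)); split.
  by case: (b); [left|right].
have [_ _ /(_ hb)[k kn [h1 h2]]] :=
  stopped_trichotomy (step i b 0) (a0 j) (H0 j) (n j) w.
have e l : partial_sum (step i b 0) l w = potential (side_env b (fun x => om i x w)) l.
  rewrite partial_sum_step // add0n.
  by rewrite [potential _ 0]/potential big_geq // subr0.
exists k => //; rewrite -!e; split => // l lk.
by rewrite -e ltW //; exact: h2.
Qed.

Lemma sigma_sites_bigI (L : eqType) (s : seq L) (D : L -> set ('I_I * int)) (E : L -> set Om) :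
  (forall l, sigma_sites (D l) (E l)) ->
  sigma_sites (\bigcup_(l in [set` s]) D l) (\big[setI/setT]_(l <- s) E l).
Proof.
move=> hE; rewrite big_seq.
apply: (@bigsetI_measurable _ (g_sigma_algebraType _)) => l ls.
by apply: sigma_join_sub (hE l) => p Dp; exists l.
Qed.

Lemma sigma_sites_prod (L : eqType) (s : seq L) (D : L -> set ('I_I * int)) (E : L -> set Om) :
  uniq s -> (forall l l', l != l' -> D l `&` D l' = set0) ->
  (forall l, sigma_sites (D l) (E l)) ->
  P (\big[setI/setT]_(l <- s) E l) = (\prod_(l <- s) P (E l))%E.
Proof.
move=> + dD hE; elim: s => [_|x s IH /= /andP[xs us]].
  by rewrite !big_nil; exact: probability_setT.
rewrite !big_cons -IH //.
apply: (sigma_sites_independent (D1 := D x)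
  (D2 := \bigcup_(l in [set` s]) D l)) => //; last exact: sigma_sites_bigI.
apply/seteqP; split => // p [Dx [l /= ls Dl]].
have xl : x != l by apply: contraNneq xs => ->.
by have : (D x `&` D l) p by []; rewrite dD.
Qed.

(** * Deep valleys at infinitely many scales *)

Section Scales.
Local Notation C := (- ln eps).
Variable delta : R.
Hypothesis delta01 : 0 < delta <= 1.

Let C_ge0 : 0 <= C. Proof. exact: le_trans (truncated_log_bound 0). Qed.

(** One summand per requirement: [8 / eps] for [valley_return_ge]; [C / delta] to make a single
    step, and the potential where a block starts, small against [delta] times the scale;
    [432 / (site_var i * delta)] to make a late exit unlikely. *)
Definition scale_bound : nat :=
  (Num.bound (8 / eps) + Num.bound (C / delta)
   + \sum_(i < I) Num.bound (432 / (site_var i * delta))).+1.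

Let eps_gt0 : 0 < eps. Proof. by case/andP: eps01. Qed.
Let delta_gt0 : 0 < delta. Proof. by case/andP: delta01. Qed.
Let var_gt0 i : 0 < site_var i. Proof. exact: site_var_gt0. Qed.

Let bound_le (x : R) (N : nat) : 0 <= x -> (Num.bound x <= N)%N -> x <= N%:R.
Proof. by move=> x0 h; apply: le_trans (ltW (archi_boundP x0)) _; rewrite ler_nat. Qed.

Lemma scale_bound_eps : 8 / eps <= scale_bound%:R.
Proof.
apply: bound_le; first by rewrite divr_ge0 // ltW.
by apply: leqW; rewrite -addnA; exact: leq_addr.
Qed.

Lemma scale_bound_log : C <= delta * scale_bound%:R.
Proof.
rewrite mulrC -ler_pdivrMr //; apply: bound_le; first by rewrite divr_ge0 // ltW.
by apply: leqW; rewrite -addnA; apply: leq_trans (leq_addl _ _); exact: leq_addr.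
Qed.

Lemma scale_bound_var i : 432 / (site_var i * delta) <= scale_bound%:R.
Proof.
apply: bound_le; first by rewrite divr_ge0 // mulr_ge0 // ltW.
rewrite /scale_bound (bigD1 i) //=; apply: leqW.
by apply: leq_trans (leq_addl _ _); exact: leq_addr.
Qed.

(** For [a = delta h] and [H = 4 h] one has [a + H + C <= 6 h], so optional stopping gives
    [delta <= 6 p + 216 / (site_var i * h)]. The last term is at most [delta / 2] by the choice of
    [scale_bound]. *)
Lemma prob_above_scale i b K h : (scale_bound <= h)%N ->
  delta / 12 <= fine (P (above (step i b K) (delta * h%:R) (4 * h%:R) (h ^ 3))).
Proof.
move=> Nh; have h0 : (0 < h)%N by exact: leq_trans Nh.
have hR : 0 < h%:R :> R by rewrite ltr0n.
have NhR : scale_bound%:R <= h%:R :> R by rewrite ler_nat.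
have d0 := delta_gt0; have /andP[_ d1] := delta01.
have s0 := var_gt0 i.
have n0 : (0 < h ^ 3)%N by rewrite expn_gt0 h0.
have := prob_above_step i b K
  (mulr_gt0 d0 hR) (mulr_gt0 (ltr0n _ 4) hR) n0.
set p := fine _; have p0 : 0 <= p by rewrite fine_ge0.
have hC : C <= h%:R.
  apply: le_trans scale_bound_log _; apply: le_trans NhR.
  by rewrite ler_piMl.
have hv : 432 <= h%:R * (site_var i * delta).
  by rewrite -ler_pdivrMr ?mulr_gt0 //; apply: le_trans (scale_bound_var i) _.
have hdh : delta * h%:R <= h%:R by rewrite ler_piMl // ltW.
rewrite natrX; have C0 := C_ge0; move: p0 hC hdh hv hR s0 d0 C0.
move: C (site_var i) (h%:R) p delta => c s x p de p0 hC hdh hv x0 s0 d0 C0 main.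
pose X := de * x + 4 * x + c.
have X6 : X <= 6 * x by rewrite /X; lra.
have dx0 : 0 < de * x by exact: mulr_gt0.
have X0 : 0 <= X by rewrite /X; lra.
have sx0 : 0 < s * x ^+ 3 by rewrite mulr_gt0 // exprn_gt0.
have : de * x <= 6 * x * (p + (6 * x) ^+ 2 / (s * x ^+ 3)).
  apply: le_trans main _; apply: ler_pM => //.
    by rewrite addr_ge0 // divr_ge0 ?sqr_ge0 // ltW.
  rewrite lerD2l ler_pM2r ?invr_gt0 //.
  by apply: lerXn2r; rewrite ?nnegrE // mulr_ge0 // ltW.
have -> : 6 * x * (p + (6 * x) ^+ 2 / (s * x ^+ 3)) = x * (6 * p + 216 / (s * x)).
  by field; rewrite !gt_eqF.
rewrite mulrC ler_pM2l //.
have : 216 / (s * x) <= de / 2.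
  rewrite ler_pdivrMr ?mulr_gt0 //; move: hv.
  have -> : x * (s * de) = 2 * (de / 2 * (s * x)) by field.
  by lra.
by lra.
Qed.

(* Block [k] consists of the sites at distance between [start k + 1]
   and [start k + scale k ^ 3]. The exit time at scale [h] is of order [h ^ 2], so
   [h ^ 3] sites suffice; [scale k] dominates [start k], which makes the
   potential at the beginning of the block negligible. *)
Fixpoint start (k : nat) : nat :=
  if k is k'.+1 then (start k' + ((scale_bound + k') * (start k').+1) ^ 3)%N else 0%N.

Definition scale (k : nat) : nat := ((scale_bound + k) * (start k).+1)%N.

Lemma startS k : start k.+1 = (start k + scale k ^ 3)%N. Proof. by []. Qed.

Lemma leq_start k l : (k <= l)%N -> (start k <= start l)%N.
Proof.
move=> /subnK <-; elim: (l - k)%N => // n IH.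
by rewrite addSn startS; apply: leq_trans IH _; exact: leq_addr.
Qed.

Definition shell (k : nat) : set ('I_I * int) :=
  [set p | exists b, exists2 m, (start k <= m < start k.+1)%N & p.2 = site b m].

Lemma shell_disjoint k l : k != l -> shell k `&` shell l = set0.
Proof.
wlog kl : k l / (k < l)%N.
  move=> wl; rewrite neq_ltn => /orP[kl|lk]; first by apply: wl => //; rewrite neq_ltn kl.
  by rewrite setIC; apply: wl => //; rewrite neq_ltn lk.
move=> _; apply/seteqP; split => // p [[b [m mk e]] [b' [m' mk' e']]].
have := leq_start kl => le_kl.
have mm : (m < m')%N.
  case/andP: mk mk' => _ h1 /andP[h2 _].
  by apply: leq_trans h1 _; exact: leq_trans h2.
move: e'; rewrite e /site; case: b {e}; case: b' => h; lia.
Qed.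

Definition good_side k (l : 'I_I * bool) : set Om :=
  above (step l.1 l.2 (start k)) (delta * (scale k)%:R) (4 * (scale k)%:R) (scale k ^ 3).

Definition good k : set Om := \big[setI/setT]_(l <- enum {: 'I_I * bool}) good_side k l.

Let good_side_block k l :
  sigma_sites (block l.1 l.2 (start k) (scale k ^ 3)) (good_side k l).
Proof. exact: above_step_block. Qed.

Lemma good_shell k : sigma_sites (shell k) (good k).
Proof.
have := sigma_sites_bigI (s := enum {: 'I_I * bool}) (@good_side_block k).
apply: sigma_join_sub => p [[i b] _ [_ [l hl e]]]; exists b, (start k + l)%N => //.
by rewrite startS leq_addr ltn_add2l.
Qed.

Definition good_prob : R := (delta / 12) ^+ (I * 2).

(** The [2 I] events, one per environment and side, depend on disjoint sets of sites, so their
    probabilities multiply. *)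
Lemma prob_good_ge k : (good_prob%:E <= P (good k))%E.
Proof.
rewrite (sigma_sites_prod (enum_uniq _) _ (@good_side_block k)); last first.
  move=> [i b] [i' b'] ne; apply/seteqP; split => // -[j x] [[/= -> [l _ ->]] [/= ii [l' _ e]]].
  by move: ne e; rewrite ii /site; case: b; case: b' => /=; rewrite ?eqxx // => _ h; lia.
rewrite (eq_bigr (fun l => (fine (P (good_side k l)))%:E)); last first.
  move=> l _; rewrite fineK // fin_num_measure //.
  exact: sigma_sites_measurable (@good_side_block k l).
rewrite prodEFin lee_fin /good_prob.
have -> : (I * 2 = size (enum {: 'I_I * bool}))%N.
  by rewrite -cardE card_prod card_ord card_bool.
rewrite -prodr_seq_const; apply: ler_prod => l _.
have d0 := delta_gt0; rewrite divr_ge0 ?(ltW d0) //=.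
by apply: prob_above_scale; rewrite /scale; nia.
Qed.

(** Distinct shells are disjoint, so [n] consecutive failures have probability at most
    [(1 - good_prob)^n], which tends to 0. *)
Lemma prob_never_good k0 : P (\bigcap_(k in [set k | (k0 <= k)%N]) ~` good k) = 0%E.
Proof.
have mg k : measurable (~` good k).
  by apply: measurableC; exact: sigma_sites_measurable (@good_shell k).
have gp0 : 0 < good_prob by rewrite exprn_gt0 // divr_gt0.
have Pc k : P (~` good k) = (1 - fine (P (good k)))%:E.
  have mk := sigma_sites_measurable (@good_shell k).
  by rewrite probability_setC // EFinB fineK // fin_num_measure.
have gp1 : good_prob <= 1.
  rewrite -lee_fin; apply: le_trans (prob_good_ge 0) _; apply: probability_le1.
  exact: sigma_sites_measurable (@good_shell 0).
have Pn n : (P (\bigcap_(k in [set k | (k0 <= k)%N]) ~` good k) <= ((1 - good_prob) ^+ n)%:E)%E.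
  apply: (@le_trans _ _ (P (\big[setI/setT]_(k <- iota k0 n) ~` good k))).
    rewrite le_measure ?inE //.
    - by apply: bigcap_measurable => //; exists k0 => /=.
    - exact: bigsetI_measurable.
    - rewrite -bigcap_seq => w h k /=; rewrite mem_iota => /andP[kk _].
      exact: h.
  rewrite (sigma_sites_prod (iota_uniq _ _) (@shell_disjoint)); last first.
    by move=> k; apply: sigma_algebraC; exact: good_shell.
  under eq_bigr do rewrite Pc.
  rewrite prodEFin lee_fin -[n in leRHS](size_iota k0) -prodr_seq_const.
  apply: ler_prod => k _; have mk := sigma_sites_measurable (@good_shell k).
  have fk : P (good k) \is a fin_num by rewrite fin_num_measure.
  apply/andP; split; first by rewrite subr_ge0 -lee_fin fineK //; exact: probability_le1.
  by rewrite lerD2l lerN2 -lee_fin fineK // prob_good_ge.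
apply/eqP; rewrite eq_le measure_ge0 andbT.
have cv : (fun n => (1 - good_prob) ^+ n) @ \oo --> 0.
  by apply: cvg_expr; rewrite ger0_norm ?subr_ge0 // gtrBl.
rewrite -[P _]fineK; last first.
  rewrite fin_num_measure //; apply: bigcap_measurable => //; by exists k0 => /=.
rewrite lee_fin -(cvg_lim _ cv) //; apply: limr_ge; first by apply/cvg_ex; exists 0.
apply: nearW => n; rewrite -lee_fin fineK ?Pn // fin_num_measure //.
by apply: bigcap_measurable => //; exists k0 => /=.
Qed.

Lemma ae_infinitely_often_good : {ae P, forall w, forall k0, exists2 k, (k0 <= k)%N & good k w}.
Proof.
have mbad k0 : measurable (\bigcap_(k in [set k | (k0 <= k)%N]) ~` good k).
  apply: bigcap_measurable; first by exists k0 => /=.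
  by move=> k _; apply: measurableC; exact: sigma_sites_measurable (@good_shell k).
have : P.-negligible (\bigcup_k0 \bigcap_(k in [set k | (k0 <= k)%N]) ~` good k).
  apply: negligible_bigcup => k0.
  by exists (\bigcap_(k in [set k | (k0 <= k)%N]) ~` good k); split => //; exact: prob_never_good.
apply: negligibleS => w /= h; apply: contrapT => nb; apply: h => k0.
apply: contrapT => ng; apply: nb; exists k0 => // k kk gk; apply: ng; by exists k.
Qed.

Lemma potential_bound i b w m : elliptic eps (fun x => om i x w) ->
  `|potential (side_env b (fun x => om i x w)) m| <= C * m%:R.
Proof.
move=> ell; have := partial_sum_step b 0 m ell.
rewrite add0n [potential _ 0]/potential big_geq // subr0 => <-.
rewrite /partial_sum; apply: le_trans (ler_norm_sum _ _ _) _.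
rewrite mulr_natr -[m in _ *+ m]subn0 -sumr_const_nat; apply: ler_sum => l _.
exact: step_bound.
Qed.

(** Write [h] for [scale k]. Up to the block the potential stays within [delta h] of 0. In the block
    it gains [4 h] before losing [delta h], so it reaches [(4 - delta) h >= 3 h] without going below
    [-2 delta h]. The distance is at most [start k + h^3 <= 2 h^3]. *)
Lemma good_deep_valley k w i b : elliptic eps (fun x => om i x w) -> good k w ->
  deep_valley (side_env b (fun x => om i x w)) delta (scale k) (2 * scale k ^ 3).
Proof.
move=> ell; rewrite /good -bigcap_seq => /(_ (i, b)); rewrite /= mem_enum => /(_ isT) gk.
have h0 : (0 < scale k)%N by rewrite /scale muln_gt0.
have hR : 0 < (scale k)%:R :> R by rewrite ltr0n.
have d0 := delta_gt0; have /andP[_ d1] := delta01.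
have [_ /(_ gk)[l hl [top low]] _] := stopped_trichotomy (step i b (start k))
  (mulr_gt0 d0 hR) (mulr_gt0 (ltr0n _ 4) hR) (scale k ^ 3) w.
have e m := partial_sum_step b (start k) m ell.
set V := potential _ in e *.
have CK : C * (start k)%:R <= delta * (scale k)%:R.
  apply: (@le_trans _ _ (delta * scale_bound%:R * (start k)%:R)).
    by rewrite ler_wpM2r // scale_bound_log.
  by rewrite -mulrA ler_wpM2l ?(ltW d0) // -natrM ler_nat /scale; nia.
have Vlow m : (m <= start k)%N -> - (delta * (scale k)%:R) <= V m.
  move=> mk; have := potential_bound b m ell; rewrite -/V ler_norml => /andP[h _].
  apply: le_trans h; rewrite lerN2; apply: le_trans CK.
  by rewrite ler_wpM2l ?C_ge0 // ler_nat.
have dh : delta * (scale k)%:R <= (scale k)%:R by rewrite ler_piMl // ltW.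
have dh0 : 0 < delta * (scale k)%:R by exact: mulr_gt0.
exists (start k + l)%N.
  have : (start k <= scale k)%N by apply: (leq_trans (leqnSn _)); rewrite /scale leq_pmull.
  have : (scale k <= scale k ^ 3)%N by rewrite -[X in (X <= _)%N]expn1 leq_pexp2l.
  lia.
have VK := Vlow _ (leqnn _).
rewrite -/V; split; first by move: top VK dh; rewrite e; move: (V _) (V _) => x y; lra.
move=> m ml; have [mk|km] := leqP m (start k).
  by have := Vlow _ mk; move: dh0; move: (V m) => x; lra.
have mE : m = (start k + (m - start k))%N by rewrite subnKC // ltnW.
have := low (m - start k)%N; rewrite e -mE ltn_subLR ?ml ?(ltnW km) // => /(_ isT).
by move: VK dh0; move: (V _) (V _) => x y; lra.
Qed.

End Scales.

Theorem ae_return_product_unbounded (r : nat) (J : 'I_r -> 'I_I) :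
  {ae P, forall w, forall M : R, exists n, M <= \sum_(1 <= k < n)
    srw_return R k * \prod_j pn (fun x => om (J j) x w) k.*2 0 0}.
Proof.
pose delta : R := (8 * r.+1%:R)^-1.
have r1 : 1 <= r.+1%:R :> R by rewrite ler1n.
have d01 : 0 < delta <= 1.
  by rewrite /delta invr_gt0 mulr_gt0 //= invf_le1 ?mulr_gt0 //; lra.
have IO := ae_infinitely_often_good d01.
have EL := ae_elliptic.
apply: filterS2 IO EL => w io ell M.
have [c c0 hc] := product_return_sum_ge eps01 r.
(* As [scale delta k >= k], a good scale this late has [c * scale delta k >= M]. *)
have [k kM gk] := io (Num.bound (`|M| / c)).
exists (4 ^ scale delta k).+1.
have sb_pos : (0 < scale_bound delta)%N by [].
have h0 : (0 < scale delta k)%N by rewrite /scale muln_gt0 addn_gt0 sb_pos.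
have sb_le : (scale_bound delta + k <= scale delta k)%N.
  by rewrite /scale leq_pmulr.
apply: le_trans (hc (fun j x => om (J j) x w) _ (2 * scale delta k ^ 3)%N _ h0 _ (leqnn _) _ _).
- apply: (@le_trans _ _ `|M|); first exact: ler_norm.
  rewrite mulrC -ler_pdivrMr //; apply: le_trans (ltW (archi_boundP _)) _.
    by rewrite divr_ge0 // ltW.
  by rewrite ler_nat; apply: leq_trans kM _; apply: leq_trans sb_le; exact: leq_addl.
- by move=> j; exact: ell.
- apply: le_trans (scale_bound_eps delta) _.
  by rewrite ler_nat; apply: leq_trans sb_le; exact: leq_addr.
- by move=> j; exact: (good_deep_valley d01 true (ell (J j)) gk).
- by move=> j; exact: (good_deep_valley d01 false (ell (J j)) gk).
Qed.

End RandomEnvironment.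

(** * Recurrence criterion for the joint chain *)

Section DisjointSums.
Context d (T : measurableType d) (R : realType) (Q : probability T R).
Implicit Types (A E B : set T).

Definition pr A : R := fine (Q A).

Lemma pr_ge0 A : 0 <= pr A. Proof. exact: fine_ge0. Qed.

Lemma prE A : measurable A -> Q A = (pr A)%:E.
Proof. by move=> mA; rewrite fineK // fin_num_measure. Qed.

Lemma le_pr A B : measurable A -> measurable B -> A `<=` B -> pr A <= pr B.
Proof.
by move=> mA mB AB; rewrite fine_le ?fin_num_measure // le_measure ?inE.
Qed.

Lemma pr_le1 A : measurable A -> pr A <= 1.
Proof. by move=> mA; rewrite -lee_fin -prE //; exact: probability_le1. Qed.

Lemma prU A B : measurable A -> measurable B -> A `&` B = set0 ->
  pr (A `|` B) = pr A + pr B.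
Proof.
by move=> mA mB AB; rewrite /pr measureU // fineD // fin_num_measure.
Qed.

Lemma pr_bigU (L : choiceType) (s : seq L) (A : L -> set T) : uniq s ->
  (forall l, measurable (A l)) ->
  (forall l l', l \in s -> l' \in s -> l != l' -> A l `&` A l' = set0) ->
  pr (\big[setU/set0]_(l <- s) A l) = \sum_(l <- s) pr (A l).
Proof.
move=> + mA; elim: s => [_ _|x s IH /= /andP[xs us] dA].
  by rewrite !big_nil /pr measure0.
rewrite !big_cons -IH //; last first.
  by move=> l l' ls l's; apply: dA; rewrite inE ?ls ?l's orbT.
apply: prU => //; first exact: bigsetU_measurable.
rewrite -bigcup_seq; apply/seteqP; split => // t [Ax [l /= ls Al]].
have xl : x != l by apply: contraNneq xs => ->.
have : (A x `&` A l) t by [].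
by rewrite dA // inE ?eqxx ?ls ?orbT.
Qed.

(** Equality of the total masses makes the disjoint sets [A l] exhaust [B] up to a null set, so
    cutting [E] along them loses no probability. *)
Lemma pr_refine (L : choiceType) (s : seq L) (A : L -> set T) B E : uniq s ->
  (forall l, measurable (A l)) -> measurable B -> measurable E ->
  (forall l l', l \in s -> l' \in s -> l != l' -> A l `&` A l' = set0) ->
  (forall l, l \in s -> A l `<=` B) -> \sum_(l <- s) pr (A l) = pr B ->
  pr (E `&` B) = \sum_(l <- s) pr (E `&` A l).
Proof.
move=> us mA mB mE dA AB sA; pose U := \big[setU/set0]_(l <- s) A l.
have mU : measurable U by exact: bigsetU_measurable.
have prUB : pr U = pr B by rewrite -sA; exact: pr_bigU.
have UB : U `<=` B by rewrite /U -bigcup_seq => t [l ls Al]; exact: (AB l ls).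
have mD : measurable (B `\` U) by exact: measurableD.
have prD : pr (B `\` U) = 0.
  have : pr (U `|` (B `\` U)) = pr U + pr (B `\` U).
    by apply: prU => //; rewrite setDE setICA setICr setI0.
  by rewrite setDUK // prUB => h; lra.
have -> : E `&` B = (E `&` U) `|` (E `&` (B `\` U)) by rewrite -setIUr setDUK.
rewrite prU; [|exact: measurableI|exact: measurableI|]; last first.
  by rewrite setIACA setIid setDE [U `&` _]setICA setICr !setI0.
have -> : pr (E `&` (B `\` U)) = 0.
  apply/eqP; rewrite eq_le pr_ge0 andbT -prD le_pr //; first exact: measurableI.
rewrite addr0 -pr_bigU //.
- by congr pr; rewrite /U big_distrr.
- by move=> l; exact: measurableI.
- by move=> l l' ls l's ll'; rewrite setIACA dA // setI0.
Qed.

End DisjointSums.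

(** * Last-return decomposition for a chain with finitely many moves *)

Section SteppingChain.
Context (W : eqType) (F : finType) (R : realType).
Variables (act : W -> F -> W) (K : W -> F -> R).
Hypothesis act_inj : forall x, injective (act x).
Hypothesis K_ge0 : forall x e, 0 <= K x e.
Hypothesis K_sum : forall x, \sum_e K x e = 1.
Implicit Types (x y : W) (s : seq F).

Definition position x s := foldl act x s.

Fixpoint weight x s : R :=
  if s is e :: s' then K x e * weight (act x e) s' else 1.

Fixpoint step_seqs n : seq (seq F) :=
  if n is n'.+1 then [seq e :: s | e <- enum F, s <- step_seqs n'] else [:: [::]].

Lemma weight_rcons x s e : weight x (rcons s e) = weight x s * K (position x s) e.
Proof. by elim: s x => [|f s IH] x /=; rewrite ?mulr1 ?mul1r // IH mulrA. Qed.

Lemma mem_step_seqs n s : (s \in step_seqs n) = (size s == n).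
Proof.
elim: n s => [|n IH] s; first by case: s.
apply/allpairsP/idP => [[[e s'] /= [_ s'n ->]]|].
  by rewrite /= eqSS -IH.
case: s => // e s; rewrite /= eqSS -IH => sn.
by exists (e, s); split => //=; rewrite mem_enum.
Qed.

Lemma uniq_step_seqs n : uniq (step_seqs n).
Proof.
elim: n => // n IH; rewrite /= allpairs_uniq ?enum_uniq // => -[e s] [e' s'] _ _ /=.
by case=> -> ->.
Qed.

Lemma sum_step_seqsS n (f : seq F -> R) :
  \sum_(s <- step_seqs n.+1) f s = \sum_e \sum_(s <- step_seqs n) f (e :: s).
Proof. by rewrite big_allpairs_dep /= big_enum. Qed.

Lemma weight_sum n x : \sum_(s <- step_seqs n) weight x s = 1.
Proof.
elim: n x => [|n IH] x; first by rewrite big_seq1.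
rewrite sum_step_seqsS -[RHS](K_sum x); apply: eq_bigr => e _.
by rewrite -mulr_sumr IH mulr1.
Qed.

Definition follows (f : nat -> W) x s :=
  forall k, (k <= size s)%N -> f k = position x (take k s).

Lemma follows_inj f x s s' : size s = size s' -> follows f x s -> follows f x s' -> s = s'.
Proof.
elim: s s' f x => [|e s IH] [|e' s'] f x //= [ss] h h'.
have e1 : e = e'.
  have := h 1%N isT; rewrite (h' 1%N isT) /= !take0 /= => /act_inj ->//.
rewrite -e1; congr cons; apply: (IH _ (fun k => f k.+1) (act x e)) => // k ks.
  by rewrite (h k.+1).
by rewrite (h' k.+1) ?e1.
Qed.

Variable o : W.

(** The probability of missing [o] at the times [1, ..., n] from [x]. Time 0 is not tested, so at
    [x = o] this is the probability of no return. *)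
Fixpoint avoid_prob n x : R :=
  if n is n'.+1 then
    \sum_e K x e * ((act x e != o)%:R * avoid_prob n' (act x e))
  else 1.

Lemma avoid_prob_ge0 n x : 0 <= avoid_prob n x.
Proof.
elim: n x => //= n IH x; apply: sumr_ge0 => e _.
by rewrite !mulr_ge0.
Qed.

Lemma avoid_prob_antitone n k x : (n <= k)%N -> avoid_prob k x <= avoid_prob n x.
Proof.
have S_le i y : avoid_prob i.+1 y <= avoid_prob i y.
  elim: i y => [|i IH] y.
    rewrite -[leRHS](K_sum y); apply: ler_sum => e _.
    by rewrite mulr1 ler_piMr // lern1 leq_b1.
  by apply: ler_sum => e _; rewrite ler_wpM2l // ler_wpM2l //; exact: IH.
move=> /subnK <-; elim: (k - n)%N => // i IH.
by rewrite addSn; apply: le_trans (S_le _ _) IH.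
Qed.

Context d (T : measurableType d) (Q : probability T R).
Variable X : nat -> T -> W.
Hypothesis mX : forall n y, measurable [set t | X n t = y].
Hypothesis X_weight : forall s,
  pr Q [set t | follows (fun k => X k t) o s] = weight o s.

Definition path_event s := [set t | follows (fun k => X k t) o s].

Lemma measurable_path_event s : measurable (path_event s).
Proof.
have -> : path_event s =
    \big[setI/setT]_(k <- iota 0 (size s).+1) [set t | X k t = position o (take k s)].
  rewrite -bigcap_seq; apply/seteqP; split => t h k ks.
    by apply: h; have : k \in iota 0 (size s).+1 := ks; rewrite mem_iota.
  by apply: h; change (k \in iota 0 (size s).+1); rewrite mem_iota.
by apply: bigsetI_measurable => k _; exact: mX.
Qed.

Lemma path_event_disjoint s s' : size s = size s' -> s != s' ->
  path_event s `&` path_event s' = set0.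
Proof.
move=> ss ne; apply/seteqP; split => // t [h h'].
by move/eqP: ne; apply; exact: follows_inj ss h h'.
Qed.

(** The paths made of [n] moves from [o] carry the full mass by [weight_sum], so [pr_refine] applies
    with the whole space. *)
Lemma pr_paths n E : measurable E ->
  pr Q E = \sum_(s <- step_seqs n) pr Q (E `&` path_event s).
Proof.
move=> mE; rewrite -[in LHS](setIT E).
apply: (@pr_refine _ _ _ _ _ _ _ _ _ (uniq_step_seqs n)) => //.
- exact: measurable_path_event.
- move=> s s'; rewrite !mem_step_seqs => /eqP sn /eqP s'n.
  by apply: path_event_disjoint; rewrite sn.
- rewrite (eq_bigr (weight o)) => [|s _]; last exact: X_weight.
  by rewrite weight_sum /pr probability_setT.
Qed.

Lemma pr_position n (E : set T) y : measurable E ->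
  pr Q ([set t | X n t = y] `&` E) =
  \sum_(s <- step_seqs n | position o s == y) pr Q (path_event s `&` E).
Proof.
move=> mE; rewrite (pr_paths n); last exact: measurableI.
rewrite [RHS]big_mkcond big_seq [RHS]big_seq; apply: eq_bigr => s.
rewrite mem_step_seqs => /eqP sn.
have last_pos t : path_event s t -> X n t = position o s.
  by move=> /(_ n); rewrite -sn take_size => ->.
case: eqP => [<-|ne].
  congr pr; apply/seteqP; split => t; first by move=> [[_ ?] ?].
  by move=> [ps ?]; split => //; split => //; exact: last_pos.
rewrite (_ : _ `&` _ = set0) ?/pr ?measure0 //.
apply/seteqP; split => // t [[Xt _] ps]; apply: ne.
by rewrite -Xt (last_pos t).
Qed.

Lemma pr_positionE n y :
  pr Q [set t | X n t = y] = \sum_(s <- step_seqs n | position o s == y) weight o s.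
Proof.
rewrite -[X in pr Q X]setIT pr_position //; apply: eq_bigr => s _.
by rewrite setIT; exact: X_weight.
Qed.

Definition avoids n k := [set t | forall i, (0 < i <= k)%N -> X (n + i) t <> o].

Lemma measurable_avoids n k : measurable (avoids n k).
Proof.
have -> : avoids n k = \big[setI/setT]_(i <- iota 1 k) ~` [set t | X (n + i) t = o].
  rewrite -bigcap_seq; apply/seteqP; split => t h i ik.
    by apply: h; have : i \in iota 1 k := ik; rewrite mem_iota add1n ltnS.
  by apply: h; change (i \in iota 1 k); rewrite mem_iota add1n ltnS.
by apply: bigsetI_measurable => i _; apply: measurableC; exact: mX.
Qed.

(** The Markov property at time [size s], by induction on [k]: the event is split along the next
    move, which is then appended to the path. *)
Lemma pr_path_avoids k s :
  pr Q (path_event s `&` avoids (size s) k) = weight o s * avoid_prob k (position o s).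
Proof.
elim: k s => [|k IH] s.
  rewrite mulr1 -X_weight; congr pr; apply/seteqP; split => t; first by case.
  by move=> ps; split => // i; case: i.
rewrite setIC (@pr_refine _ _ _ _ _ (enum F) (fun e => path_event (rcons s e))) ?enum_uniq //.
- rewrite /= mulr_sumr big_enum /=; apply: eq_bigr => e _.
  have [eo|ne] := eqVneq (act (position o s) e) o.
    rewrite /= mul0r !mulr0 (_ : _ `&` _ = set0) ?/pr ?measure0 //.
    apply/seteqP; split => // t [/(_ 1%N isT) + /(_ (size s).+1)].
    rewrite size_rcons leqnn addn1 => h /(_ isT).
    by rewrite -(size_rcons s e) take_size /position foldl_rcons -/(position _ _) eo size_rcons.
  rewrite /= mulr1n mul1r mulrA -weight_rcons -[act _ _]foldl_rcons -IH size_rcons.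
  congr pr; apply/seteqP; split => t.
    move=> [av ps]; split => // i /andP[i0 ik].
    by rewrite addSnnS; apply: av; rewrite /= ltnS.
  move=> [ps av]; split => //; case=> // -[|i] /andP[_ ik].
    move: (ps (size s).+1); rewrite size_rcons leqnn addn1 => /(_ isT) ->.
    rewrite -(size_rcons s e) take_size /position foldl_rcons.
    by apply/eqP.
  by rewrite -addSnnS; apply: av; rewrite /= -ltnS.
- by move=> e; exact: measurable_path_event.
- exact: measurable_path_event.
- exact: measurable_avoids.
- move=> e e' _ _ ee'; apply: path_event_disjoint; first by rewrite !size_rcons.
  by apply: contra_neq ee' => /rcons_inj[].
- move=> e _ t ps i is_; have := ps i; rewrite size_rcons => /(_ (leqW is_)) ->.
  by rewrite -cats1 takel_cat.
- rewrite big_enum /= -[RHS]mulr1; under eq_bigr do rewrite X_weight weight_rcons.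
  by rewrite -mulr_sumr K_sum X_weight.
Qed.

Definition return_prob n := pr Q [set t | X n t = o].

Lemma pr_last_return n k :
  pr Q ([set t | X n t = o] `&` avoids n k) = return_prob n * avoid_prob k o.
Proof.
rewrite pr_position; last exact: measurable_avoids.
rewrite /return_prob pr_positionE mulr_suml big_seq_cond [RHS]big_seq_cond.
apply: eq_bigr => s; rewrite mem_step_seqs => /andP[/eqP <- /eqP so].
by rewrite pr_path_avoids so.
Qed.

(* The events that the last return before time [N] occurs at time [n] are
   disjoint. *)
Lemma avoid_prob_sum_le N : avoid_prob N o * (\sum_(0 <= n < N.+1) return_prob n) <= 1.
Proof.
pose A n := [set t | X n t = o] `&` avoids n (N - n).
have mA n : measurable (A n) by apply: measurableI => //; exact: measurable_avoids.
apply: (@le_trans _ _ (\sum_(n <- iota 0 N.+1) pr Q (A n))).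
  rewrite mulr_sumr; apply: ler_sum => n _; rewrite pr_last_return mulrC.
  by rewrite ler_wpM2l ?pr_ge0 // avoid_prob_antitone // leq_subr.
rewrite -pr_bigU ?iota_uniq //.
  by apply: pr_le1; exact: bigsetU_measurable.
move=> l l'; rewrite !mem_iota /= !add0n !ltnS => lN l'N.
wlog ll' : l l' lN l'N / (l < l')%N.
  move=> wl; rewrite neq_ltn => /orP[h|h]; first by apply: wl => //; rewrite neq_ltn h.
  by rewrite setIC; apply: wl => //; rewrite neq_ltn h.
move=> _; apply/seteqP; split => // t [[_ av] [Xl' _]].
apply: (av (l' - l)%N); first by rewrite subn_gt0 ll' leq_sub2r.
by rewrite subnKC // ltnW.
Qed.

(** Since the expected number of visits diverges, [avoid_prob_sum_le] forces the escape probability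
    to 0, so almost surely no visit to [o] is the last one. The chain starts at [o], so finitely
    many visits would include a last one. *)
Theorem recurrence_criterion :
  (forall M : R, exists n, M <= \sum_(0 <= k < n) return_prob k) ->
  {ae Q, forall t, infinite_set [set n | X n t = o]}.
Proof.
move=> hM.
pose A n := [set t | X n t = o] `&` \bigcap_k avoids n k.
have mA n : measurable (A n).
  by apply: measurableI => //; apply: bigcapT_measurable => k; exact: measurable_avoids.
have A0 n : Q (A n) = 0%E.
  rewrite prE //; congr EFin; apply/eqP; rewrite eq_le pr_ge0 andbT.
  apply/ler_addgt0Pr => e e0; rewrite add0r.
  have [[|N] hN] := hM e^-1.
    by move: hN; rewrite big_geq // leNgt invr_gt0 e0.
  have := avoid_prob_sum_le N; rewrite mulrC => h.
  have S0 : 0 < \sum_(0 <= k < N.+1) return_prob k by apply: lt_le_trans hN; rewrite invr_gt0.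
  apply: (@le_trans _ _ (return_prob n * avoid_prob N o)).
    rewrite -pr_last_return le_pr //; first by apply: measurableI => //; exact: measurable_avoids.
    by apply: setIS => t; exact.
  apply: (@le_trans _ _ (avoid_prob N o)).
    by rewrite ler_piMl ?avoid_prob_ge0 //; exact: pr_le1.
  rewrite mulrC -ler_pdivlMr // mul1r in h; apply: le_trans h _.
  by rewrite -[leRHS]invrK lef_pV2 ?posrE ?invr_gt0.
have X0 : Q (~` [set t | X 0 t = o]) = 0%E.
  have := X_weight [::]; rewrite /= => h.
  rewrite probability_setC // prE // (_ : pr Q _ = 1) ?subee //.
  rewrite -h; congr pr; apply/seteqP; split => t; first by move=> Xt [|k].
  by move=> /(_ 0%N isT).
have : Q.-negligible (~` [set t | X 0 t = o] `|` \bigcup_n A n).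
  apply: negligibleU.
    by exists (~` [set t | X 0 t = o]); split => //; exact: measurableC.
  apply: negligible_bigcup => n; exists (A n); split; [exact: mA|exact: A0|by []].
apply: negligibleS => t /= ninf; apply: contrapT => nb.
have X0t : X 0 t = o by apply: contrapT => h; apply: nb; left.
have {ninf} /finite_seqP[s es] : finite_set [set n | X n t = o] by exact: contrapT.
pose p n := `[< X n t = o >].
have exp : exists n, p n by exists 0%N; apply/asboolP.
have ubp n : p n -> (n <= \max_(i <- s) i)%N.
  move=> /asboolP Xn; apply: (leq_bigmax_seq n) => //.
  by have : [set n | X n t = o] n by []; rewrite es.
case: (ex_maxnP exp ubp) => n /asboolP Xn maxn.
apply: nb; right; exists n => //; split => // k _ i /andP[i0 _] Xni.
have /maxn : p (n + i)%N by apply/asboolP.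
by rewrite -[leqRHS]addn0 leq_add2l leqNgt i0.
Qed.

End SteppingChain.

(** * Path probabilities of a nearest-neighbour chain *)

Section NearestNeighbourChain.
Context (R : realType).

Definition nn_act (x : int) (b : bool) : int := if b then x + 1 else x - 1.

Definition nn_weight (q : int -> R) (x : int) (b : bool) : R := if b then q x else 1 - q x.

Lemma nn_act_inj x : injective (nn_act x).
Proof. by move=> [] []; rewrite /nn_act // => h; exfalso; lia. Qed.

Lemma nn_weight_ge0 q x b : prob_env q -> 0 <= nn_weight q x b.
Proof. by move=> q01; rewrite /nn_weight; case: b; have := q01 x; lra. Qed.

Lemma nn_weight_sum q x : \sum_b nn_weight q x b = 1.
Proof. by rewrite big_bool /= addrC subrK. Qed.

Lemma nn_kernelE q x b : nn_kernel q x (nn_act x b) = nn_weight q x b.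
Proof.
rewrite /nn_kernel /nn_weight /nn_act; case: b; first by rewrite eqxx.
by rewrite eqxx ifF //; lia.
Qed.

Lemma sum_weight_pn q n x y :
  \sum_(s <- step_seqs bool n | position nn_act x s == y) weight nn_act (nn_weight q) x s
  = pn q n x y.
Proof.
elim: n x => [|n IH] x; first by rewrite big_mkcond big_seq1 /=; case: eqP.
rewrite big_mkcond sum_step_seqsS big_bool /= -!IH.
by congr (_ + _); rewrite mulr_sumr [RHS]big_mkcond.
Qed.

Context d (T : measurableType d) (Q : probability T R) (X : nat -> {mfun T >-> int}).

Lemma measurable_eq_state n y : measurable [set t | X n t = y].
Proof. by rewrite (_ : [set t | _] = X n @^-1` [set y]) //; exact: measurable_funPTI. Qed.

Lemma follows_rcons (f : nat -> int) x s e :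
  follows nn_act f x (rcons s e) <->
  follows nn_act f x s /\ f (size s).+1 = nn_act (position nn_act x s) e.
Proof.
split=> [h|[h hn]].
  split=> [k ks|].
    by rewrite h ?size_rcons ?(leqW ks) // -cats1 takel_cat.
  by rewrite h ?size_rcons // -(size_rcons s e) take_size /position foldl_rcons.
move=> k; rewrite size_rcons leq_eqVlt => /predU1P[->|].
  by rewrite hn -(size_rcons s e) take_size /position foldl_rcons.
by rewrite ltnS => ks; rewrite h // -cats1 takel_cat.
Qed.

Lemma pr_follows_nn q x s : prob_env q -> Q [set t | X 0%N t = x] = 1%E ->
  markov_chain Q (nn_kernel q) X ->
  pr Q [set t | follows nn_act (fun k => X k t) x s] = weight nn_act (nn_weight q) x s.
Proof.
move=> q01 X0 mc; elim/last_ind: s => [|s e IH].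
  rewrite (_ : [set t | _] = [set t | X 0%N t = x]) ?/pr ?X0 //.
  by apply/seteqP; split => t; [move=> /(_ 0%N isT)|move=> Xt [|k]].
pose past := [set t | forall k, (k <= size s)%N -> X k t = position nn_act x (take k s)].
have mpast : measurable past by exact: measurable_path_event measurable_eq_state s.
have mnext y : measurable [set t | X (size s).+1 t = y] by exact: measurable_eq_state.
rewrite weight_rcons -IH.
have -> : [set t | follows nn_act (fun k => X k t) x (rcons s e)] =
    [set t | X (size s).+1 t = nn_act (position nn_act x s) e] `&` past.
  by apply/seteqP; split => t; [move=> /follows_rcons[]|move=> [h1 h2]; apply/follows_rcons].
(* The Markov property says nothing about a null past; there both sides vanish. *)
have [p0|p0] := eqVneq (Q past) 0%E.
  have le : pr Q ([set t | X (size s).+1 t = nn_act (position nn_act x s) e] `&` past) <= pr Q past.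
    by apply: le_pr => //; exact: measurableI.
  have e0 : pr Q past = 0 by rewrite /pr p0.
  rewrite [X in _ = X * _]e0 mul0r; apply/eqP; rewrite eq_le pr_ge0 andbT.
  by rewrite -e0.
have := mc (size s) (fun k => position nn_act x (take k s)) (nn_act (position nn_act x s) e) p0.
rewrite /= take_size nn_kernelE /cond_prob => <-.
rewrite mulrC divfK //; apply: contra_neq p0 => h.
by rewrite prE // /pr h.
Qed.

End NearestNeighbourChain.

(** * The joint chain of independent coordinates *)

Section ProductChain.
Context (R : realType) (C : finType) (q : C -> int -> R).
Hypothesis q01 : forall c, prob_env (q c).

Local Notation W := {ffun C -> int}.
Local Notation F := {ffun C -> bool}.

Definition prod_act (x : W) (e : F) : W := [ffun c => nn_act (x c) (e c)].

Definition prod_weight (x : W) (e : F) : R := \prod_c nn_weight (q c) (x c) (e c).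

Lemma prod_act_inj x : injective (prod_act x).
Proof.
move=> e e' /ffunP h; apply/ffunP => c; have := h c; rewrite !ffunE.
exact: nn_act_inj.
Qed.

Lemma prod_weight_ge0 x e : 0 <= prod_weight x e.
Proof. by apply: prodr_ge0 => c _; exact: nn_weight_ge0. Qed.

Lemma prod_weight_sum x : \sum_e prod_weight x e = 1.
Proof.
rewrite /prod_weight -(bigA_distr_bigA (fun c b => nn_weight (q c) (x c) b)).
by apply: big1 => c _; exact: nn_weight_sum.
Qed.

Lemma position_prod x s c :
  position prod_act x s c = position nn_act (x c) [seq e c | e : F <- s].
Proof. by elim: s x => //= e s IH x; rewrite IH ffunE. Qed.

Lemma weight_prod x s : weight prod_act prod_weight x s =
  \prod_c weight nn_act (nn_weight (q c)) (x c) [seq e c | e : F <- s].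
Proof.
elim: s x => [|e s IH] x /=; first by rewrite big1.
by rewrite IH big_split /=; congr (_ * _); apply: eq_bigr => c _; rewrite ffunE.
Qed.

Context d (T : measurableType d) (Q : probability T R) (X : C -> nat -> {mfun T >-> int}).
Hypothesis X_indep : independent Q (fun c => sigma_of (X c)).
Hypothesis X_start : forall c, Q [set t | X c 0%N t = 0] = 1%E.
Hypothesis X_markov : forall c, markov_chain Q (nn_kernel (q c)) (X c).

Definition joint n t : W := [ffun c => X c n t].

Lemma joint_indep (B : C -> set T) : (forall c, sigma_of (X c) (B c)) ->
  pr Q (\bigcap_c B c) = \prod_c pr Q (B c).
Proof.
move=> hB.
have sub c : sigma_of (X c) `<=` measurable.
  apply: smallest_sub; first exact: sigma_algebra_measurable.
  by move=> _ [n _ [A mA <-]]; exact: measurable_funP.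
have -> : \bigcap_c B c = \bigcap_(c in [set` enum C]) B c.
  by apply/seteqP; split => t h c _; apply: h; rewrite //= mem_enum.
rewrite /pr (independent_seq X_indep) ?enum_uniq //.
rewrite (eq_bigr (fun c => (pr Q (B c))%:E)); last first.
  by move=> c _; rewrite prE //; exact: sub (hB c).
by rewrite prodEFin /= big_enum.
Qed.

Lemma state_sigma c n y : sigma_of (X c) [set t | X c n t = y].
Proof.
apply: sub_sigma_algebra; exists n => //; exists [set y] => //.
by rewrite setTI.
Qed.

Lemma follows_sigma c x s : sigma_of (X c) [set t | follows nn_act (fun k => X c k t) x s].
Proof.
have -> : [set t | follows nn_act (fun k => X c k t) x s] =
    \big[setI/setT]_(k <- iota 0 (size s).+1) [set t | X c k t = position nn_act x (take k s)].
  rewrite -bigcap_seq; apply/seteqP; split => t h k ks.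
    by apply: h; have : k \in iota 0 (size s).+1 := ks; rewrite mem_iota.
  by apply: h; change (k \in iota 0 (size s).+1); rewrite mem_iota.
apply: (@bigsetI_measurable _ (g_sigma_algebraType _)) => k _.
exact: state_sigma.
Qed.

Lemma joint_eqE n (y : W) : [set t | joint n t = y] = \bigcap_c [set t | X c n t = y c].
Proof.
apply/seteqP; split => t h.
  by move=> c _; rewrite /= -h ffunE.
by apply/ffunP => c; rewrite ffunE; exact: h.
Qed.

Lemma measurable_joint n (y : W) : measurable [set t | joint n t = y].
Proof.
rewrite joint_eqE; apply: fin_bigcap_measurable => // c _.
exact: measurable_eq_state.
Qed.

Lemma pr_joint_follows s :
  pr Q [set t | follows prod_act (fun k => joint k t) [ffun=> 0] s] =
  weight prod_act prod_weight [ffun=> 0] s.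
Proof.
have -> : [set t | follows prod_act (fun k => joint k t) [ffun=> 0] s] =
   \bigcap_c [set t | follows nn_act (fun k => X c k t) 0 [seq e c | e : F <- s]].
  apply/seteqP; split => t h.
    move=> c _ k; rewrite size_map => /h /ffunP /(_ c).
    by rewrite ffunE position_prod ffunE map_take.
  move=> k ks; apply/ffunP => c; rewrite ffunE position_prod ffunE map_take.
  by apply: (h c) => //; rewrite size_map.
rewrite joint_indep; last by move=> c; exact: follows_sigma.
rewrite weight_prod; apply: eq_bigr => c _; rewrite ffunE.
exact: pr_follows_nn.
Qed.

Lemma pr_joint_return n : pr Q [set t | joint n t = [ffun=> 0]] = \prod_c pn (q c) n 0 0.
Proof.
rewrite joint_eqE joint_indep; last by move=> c; exact: state_sigma.
apply: eq_bigr => c _; rewrite ffunE -sum_weight_pn.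
apply: (@pr_positionE int bool R nn_act (nn_weight (q c)) nn_act_inj (nn_weight_sum (q c))
  0 _ T Q (X c) (measurable_eq_state (X c))) => s.
exact: pr_follows_nn.
Qed.

Lemma joint_recurrent :
  (forall M : R, exists n, M <= \sum_(0 <= k < n) \prod_c pn (q c) k 0 0) ->
  {ae Q, forall t, infinite_set [set n | joint n t = [ffun=> 0]]}.
Proof.
move=> hM.
apply: (recurrence_criterion prod_act_inj prod_weight_ge0 prod_weight_sum measurable_joint
  pr_joint_follows) => M.
have [n hn] := hM M; exists n; apply: le_trans hn _.
by apply: ler_sum => k _; rewrite /return_prob pr_joint_return.
Qed.

Lemma joint_transient (M : R) :
  (forall n, \sum_(0 <= k < n) \prod_c pn (q c) k 0 0 <= M) ->
  {ae Q, forall t, finite_set [set n | joint n t = [ffun=> 0]]}.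
Proof.
move=> hM.
have hS n : \sum_(0 <= k < n) fine (Q [set t | joint k t = [ffun=> 0]]) <= M.
  by rewrite (eq_bigr _ (fun k _ => pr_joint_return k)).
have := borel_cantelli_bounded (fun n => measurable_joint n [ffun=> 0]) hS.
apply: filterS => t [n0 hn0].
apply: (sub_finite_set _ (finite_II n0)) => n /= Xn.
by rewrite ltnNge; apply/negP => /hn0.
Qed.

End ProductChain.

(** * Even times and the harmonic series *)

Section SumsOverTimes.
Context (R : realType).
Implicit Types (v : nat -> R) (n : nat).

Lemma odd_zero_sum_le v n : (forall k, 0 <= v k) -> (forall k, odd k -> v k = 0) ->
  \sum_(0 <= k < n) v k <= \sum_(0 <= k < n) v k.*2.
Proof.
move=> v0 vodd.
have e k : \sum_(0 <= i < k.*2) v i = \sum_(0 <= i < k) v i.*2.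
  elim: k => [|k IH]; first by rewrite !big_geq.
  by rewrite doubleS !big_nat_recr //= IH (vodd k.*2.+1) ?addr0 //= odd_double.
rewrite -e (big_cat_nat (n := n) (p := n.*2)) //=; last by rewrite -addnn leq_addr.
by rewrite lerDl sumr_ge0.
Qed.

Lemma harmonic_unbounded (M : R) : exists n, M <= \sum_(1 <= k < n) (k%:R)^-1.
Proof.
have h n : n%:R / 2 <= \sum_(1 <= k < 2 ^ n) (k%:R)^-1 :> R.
  elim: n => [|n IH]; first by rewrite mul0r big_geq.
  rewrite (big_cat_nat (n := (2 ^ n)%N)) ?expn_gt0 //=; last by rewrite leq_exp2l.
  rewrite -natr1 mulrDl lerD //.
  apply: (@le_trans _ _ (\sum_(2 ^ n <= k < 2 ^ n.+1) ((2 ^ n.+1)%:R)^-1)).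
    have e : (2 ^ n.+1 - 2 ^ n = 2 ^ n)%N by rewrite expnS; lia.
    rewrite sumr_const_nat e -[leRHS]mulr_natl expnS natrM invfM mulrCA.
    have p0 : (2 ^ n)%:R != 0 :> R by rewrite pnatr_eq0 expn_eq0.
    by rewrite mulfV // mulr1 mul1r.
  apply: ler_sum_nat => k /andP[k1 k2].
  have k0 : (0 < k)%N by apply: leq_trans k1; rewrite expn_gt0.
  by rewrite lef_pV2 ?posrE ?ltr0n ?expn_gt0 // ler_nat ltnW.
exists (2 ^ Num.bound (2 * `|M|))%N; apply: le_trans (h _).
rewrite ler_pdivlMr // mulrC; apply: (@le_trans _ _ (2 * `|M|)).
  by rewrite ler_pM2l // ler_norm.
by apply: ltW; apply: archi_boundP; rewrite mulr_ge0.
Qed.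

End SumsOverTimes.

(** * Recurrence and transience of the joint walk according to [m] and [d] *)

Theorem theorem1p1 (R : realType) (d m r I : nat)
  (hd : (m + r = d)%N) (d_ge1 : (1 <= d)%N)
  (hI : (I <= r)%N) (I_ge1 : (1 <= r)%N -> (1 <= I)%N)
  (* the random environment *)
  (dO : measure_display) (Omega : measurableType dO) (P : probability Omega R)
  (omega : 'I_r -> int -> {RV P >-> R})
  (omega01 : forall j x w, 0 < omega j x w < 1)
  (omega_iid : forall j, iid (omega j))
  (omega_indep :
    independent P (fun i : 'I_I => sigma_of (omega (widen_ord hI i))))
  (omega_copy : forall j : 'I_r, (I <= j)%N ->
    exists i : 'I_I, forall x w, omega j x w = omega (widen_ord hI i) x w)
  (eps0 : R) (heps0 : 0 < eps0 < 2^-1)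
  (omega_elliptic : forall j,
    P [set w | eps0 <= omega j 0 w <= 1 - eps0] = 1%E)
  (omega_rec : forall j, ('E_P[(fun w => ln (rho (omega j 0 w)))%R] = 0)%E)
  (omega_var : forall j, (0 < 'E_P[(fun w => ln (rho (omega j 0 w)) ^+ 2)%R])%E)
  (* the walk and its quenched laws *)
  (dT : measure_display) (T : measurableType dT)
  (S : 'I_m -> nat -> {mfun T >-> int}) (Z : 'I_r -> nat -> {mfun T >-> int})
  (Pq : Omega -> 'rV[int]_(m + r) -> probability T R)
  (hPq : forall w x, quenched_law S Z (fun j y => omega j y w) x (Pq w x)) :
  ((m <= 1)%N \/ (m = 2%N /\ d = 2%N) ->
    {ae P, forall w, recurrent (Pq w 0) (walk S Z)}) /\
  (~ ((m <= 1)%N \/ (m = 2%N /\ d = 2%N)) ->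
    {ae P, forall w, transient (Pq w 0) (walk S Z)}).
Proof.
pose C := ('I_m + 'I_r)%type.
pose X (c : C) : nat -> {mfun T >-> int} := match c with inl i => S i | inr j => Z j end.
pose q w (c : C) : int -> R :=
  match c with inl _ => fun=> 2^-1 | inr j => fun y => omega j y w end.
have q01 w c : prob_env (q w c).
  by case: c => [i|j]; [exact: prob_env_half|move=> x; exact: omega01].
have X_indep w : independent (Pq w 0) (fun c => sigma_of (X c)).
  have := quenched_independent (hPq w 0).
  by congr independent; apply/funext => -[].
have walk0 n t : (walk S Z n t = 0) <-> joint X n t = [ffun=> 0].
  split=> [h|/ffunP h].
    apply/ffunP => -[i|j]; rewrite !ffunE.
      by have := congr1 (fun y : 'rV_(m + r) => y 0 (lshift r i)) h; rewrite row_mxEl !mxE.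
    by have := congr1 (fun y : 'rV_(m + r) => y 0 (rshift m j)) h; rewrite row_mxEr !mxE.
  apply/rowP => i; rewrite mxE; case: splitP => k _; rewrite !mxE.
    by have := h (inl k); rewrite !ffunE.
  by have := h (inr k); rewrite !ffunE.
have walk0E t : [set n | walk S Z n t = 0] = [set n | joint X n t = [ffun=> 0]].
  by apply/seteqP; split => n /walk0.
have mX c n y : measurable [set t | X c n t = y] by exact: measurable_eq_state.
have X_start w c : Pq w 0 [set t | X c 0%N t = 0] = 1%E.
  apply/eqP; rewrite eq_le probability_le1 //=.
  rewrite -(quenched_start (hPq w 0)) le_measure ?inE //.
    have -> : [set t | walk S Z 0 t = 0] = [set t | joint X 0 t = [ffun=> 0]].
      by apply/seteqP; split => t /walk0.
    exact: measurable_joint.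
  by move=> t /walk0 /ffunP /(_ c); rewrite !ffunE.
have X_markov w c : markov_chain (Pq w 0) (nn_kernel (q w c)) (X c).
  by case: c => [i|j]; [exact: quenched_srw (hPq w 0) i|exact: quenched_rwre (hPq w 0) j].
have prodE w k : \prod_c pn (q w c) k 0 0 =
    pn (fun=> 2^-1) k 0 0 ^+ m * \prod_j pn (fun x => omega j x w) k 0 0.
  by rewrite big_sumType /= prodr_const card_ord.
have prod_ge0 w k : 0 <= \prod_c pn (q w c) k 0 0 by apply: prodr_ge0 => c _; exact: pn_ge0.
have rec w : (forall M : R, exists n, M <= \sum_(1 <= k < n)
      (srw_return R k ^+ m * \prod_j pn (fun x => omega j x w) k.*2 0 0)) ->
    recurrent (Pq w 0) (walk S Z).
  move=> hM; rewrite /recurrent.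
  have : {ae Pq w 0, forall t, infinite_set [set n | joint X n t = [ffun=> 0]]}.
    apply: (joint_recurrent (q01 w) (X_indep w) (X_start w) (X_markov w)) => M.
    have [n hn] := hM M; exists n.*2; apply: le_trans hn _.
    apply: le_trans (even_sum_le n (prod_ge0 w)).
    have [n1|n1] := leqP n 1; first by rewrite big_geq ?sumr_ge0.
    rewrite [leRHS]big_ltn ?(ltnW n1) // ler_wpDl //.
    by apply: ler_sum => k _; rewrite prodE.
  by apply: filterS => t; rewrite walk0E.
(* A simple-walk factor, present since [0 < m], vanishes at odd times, so bounding the sum over even
   times is enough. *)
have trans w M : (0 < m)%N -> (forall n, \sum_(0 <= k < n)
      (srw_return R k ^+ m * \prod_j pn (fun x => omega j x w) k.*2 0 0) <= M) ->
    transient (Pq w 0) (walk S Z).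
  move=> m0 hM; rewrite /transient.
  have : {ae Pq w 0, forall t, finite_set [set n | joint X n t = [ffun=> 0]]}.
    apply: (joint_transient (q01 w) (X_indep w) (X_start w) (X_markov w) (M := M)) => n.
    apply: le_trans (hM n).
    apply: le_trans (odd_zero_sum_le n (prod_ge0 w) _) _.
      by move=> k ok; rewrite prodE pn_odd0 // expr0n -leqn0 leqNgt m0 mul0r.
    by apply: ler_sum => k _; rewrite prodE.
  by apply: filterS => t; rewrite walk0E.
have p_ge0 w j k : 0 <= pn (fun x => omega j x w) k 0 0.
  by apply: pn_ge0 => x; exact: omega01.
have p_le1 w j k : pn (fun x => omega j x w) k 0 0 <= 1.
  by apply: pn_le1 => x; exact: omega01.
have u0 k := srw_return_gt0 R k.
have u1 k : srw_return R k <= 1 by apply: pn_le1; exact: prob_env_half.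
pose om (i : 'I_I) := omega (widen_ord hI i).
have om01 i x w : 0 < om i x w < 1 by exact: omega01.
have om_iid i : iid (om i) by exact: omega_iid.
have om_elliptic i : P [set w | eps0 <= om i 0 w <= 1 - eps0] = 1%E by exact: omega_elliptic.
have om_rec i : ('E_P[(fun w => ln (rho (om i 0 w)))%R] = 0)%E by exact: omega_rec.
have om_var i : (0 < 'E_P[(fun w => ln (rho (om i 0 w)) ^+ 2)%R])%E by exact: omega_var.
split=> [[m1|[m2 d2]]|hm].
- have /choice[J hJ] : forall j : 'I_r, exists i : 'I_I, forall x w, omega j x w = om i x w.
    move=> j; have [Ij|jI] := leqP I j; first exact: omega_copy.
    exists (Ordinal jI) => x w; rewrite /om; congr (omega _ x w).
    exact: val_inj.
  have := ae_return_product_unbounded om01 om_iid omega_indep heps0 om_elliptic om_rec om_var J.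
  apply: filterS => w hw; apply: rec => M; have [n hn] := hw M; exists n.
  apply: le_trans hn _; apply: ler_sum => k _.
  have e j : (fun x => omega j x w) = (fun x => om (J j) x w).
    by apply/funext => x; exact: hJ.
  rewrite (eq_bigr (fun j => pn (fun x => omega j x w) k.*2 0 0)); last by move=> j _; rewrite e.
  rewrite ler_wpM2r ?prodr_ge0 //.
  (* The lower bound contains one simple-walk factor; for [m = 0] it is compared with 1. *)
  have /orP[/eqP ->|/eqP ->] : (m == 0) || (m == 1)%N by lia.
    by rewrite expr0.
  by rewrite expr1.
(* With two simple walks and no environment the terms are at least [1 / (4 k)], and the harmonic
   series diverges. *)
- have r0 : r = 0%N by lia.
  apply: aeW => w; apply: rec => M.
  have [n hn] := harmonic_unbounded (4 * `|M|); exists n.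
  apply: (@le_trans _ _ (4^-1 * \sum_(1 <= k < n) (k%:R)^-1)).
    rewrite mulrC ler_pdivlMr // mulrC; apply: le_trans hn.
    by rewrite ler_pM2l // ler_norm.
  rewrite mulr_sumr; apply: ler_sum_nat => k /andP[k0 _].
  rewrite big1 ?mulr1; last by move=> j; have := ltn_ord j; rewrite {2}r0.
  rewrite m2 -invfM -[leLHS]mul1r ler_pdivrMr ?mulr_gt0 ?ltr0n // -natrM.
  exact: srw_return_ge.
have [m3|m2] := leqP 3 m.
  (* Three simple walks already give a convergent sum, whatever the environment; all other factors
     are at most 1. *)
  apply: aeW => w; apply: (trans w 2) => [|n]; first exact: leq_trans m3.
  apply: le_trans (srw_return_cube_sum R n); apply: ler_sum => k _.
  apply: (@le_trans _ _ (srw_return R k ^+ m)).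
    by rewrite ler_piMr ?exprn_ge0 ?(ltW (u0 k)) // prodr_ile1 // => j _; rewrite p_ge0 p_le1.
  by rewrite ler_wiXn2l // ?u1 // ltW.
have {m2}m2 : m = 2%N.
  by apply/eqP; rewrite eqn_leq -ltnS m2 /= ltnNge; apply/negP => h; apply: hm; left.
have r1 : (0 < r)%N.
  by rewrite lt0n; apply/eqP => r0; apply: hm; right; split => //; lia.
(* One environment suffices: the two simple walks contribute at most [1 / k], and the remaining
   factors at most 1. *)
have i0 : 'I_I := Ordinal (I_ge1 r1).
have := ae_harmonic_return_bounded om01 om_iid omega_indep heps0 om_elliptic om_rec om_var i0.
(* The summand 1 accounts for time 0, which the harmonic sum leaves out. *)
apply: filterS => w [K hK]; apply: (trans w (1 + K)); first by rewrite m2.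
have term k : (0 < k)%N -> srw_return R k ^+ m * \prod_j pn (fun x => omega j x w) k.*2 0 0
    <= pn (fun x => om i0 x w) k.*2 0 0 / k%:R.
  move=> k0; rewrite mulrC; apply: ler_pM.
  - exact: prodr_ge0.
  - by rewrite exprn_ge0 // ltW.
  - rewrite (bigD1 (widen_ord hI i0)) //= ler_piMr // prodr_ile1 // => j _.
    by rewrite p_ge0 p_le1.
  rewrite m2 -[leRHS]mul1r ler_pdivlMr ?ltr0n //; apply: le_trans (srw_return_le R k).
  by rewrite ler_wpM2l ?sqr_ge0 // ler_nat -addnn; lia.
move=> [|n]; first by rewrite big_geq // addr_ge0 //; have := hK 0%N; rewrite big_geq.
rewrite big_ltn // lerD //.
  by rewrite srw_return0 expr1n mul1r prodr_ile1 // => j _; rewrite p_ge0 p_le1.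
by apply: le_trans (hK n.+1); apply: ler_sum_nat => k /andP[k0 _]; exact: term.
Qed.
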